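(* Let $T>0$, let $\phi$ be the solution cocycle of the equation $dY_t=F(Y_t)\,d\mathbf Z_t(\omega)+F_0(Y_t)\,dt$ driven by an $\mathbf X$-controlled rough path cocycle $\mathbf Z$, with $F\in C_b^3(W,\mathcal L(U,W))$ and $F_0\in C_b^1(W,W)$, and let $\alpha\ne\tfrac12$. Then there exists an increasing polynomial-type function $Q_{\mathrm{lin}}$ such that for every $\omega\in\Omega$ and every $z_0\in W\times\mathcal L(V,W)$ $$\sup_{0\le t\le T}\log^+\|D_{z_0}\phi_t^\omega\|\le Q_{\mathrm{lin}}\bigl(\|z_0\|,\ \|\mathbf Z(\omega)\|_{\mathcal C^\alpha_{\mathbf X(\omega)}([0,T])},\ \|\mathbf X(\omega)\|_{\alpha,[0,T]}\bigr).$$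
   Context: $U,V,W$ are finite-dimensional Banach spaces, $\alpha\in(1/3,1/2]$, $X_{s,t}:=X_t-X_s$, $\log^+x=\max\{\log x,0\}$. $C_b^k$: $k$-times continuously differentiable maps with bounded derivatives up to order $k$. ''Increasing polynomial-type function'': nondecreasing in each argument and of at most polynomial growth. $(\Omega,\mathcal F,\mathbb P,\{\theta_t\}_{t\in\mathbb R})$ is an invertible measure-preserving dynamical system (jointly measurable group of $\mathbb P$-preserving maps). Rough path on an interval $I$: $\mathbf X=(X,\mathbb X)$, $X$ $V$-valued, $\mathbb X$ $V\otimes V$-valued, $\mathbb X_{s,t}=\mathbb X_{s,u}+\mathbb X_{u,t}+X_{s,u}\otimes X_{u,t}$, $\|\mathbf X\|_{\alpha,I}:=\max\{\|X\|_{\alpha,I},\|\mathbb X\|_{2\alpha,I}^{1/2}\}<\infty$ (Hölder seminorms). $\mathbf X$-controlled path: $\mathbf Z=(Z,Z')$ with $R^Z_{s,t}:=Z_{s,t}-Z'_sX_{s,t}$ and $\|\mathbf Z\|_{\mathcal C^\alpha_{\mathbf X}(I)}:=\max\{\|Z\|_{\infty,I},\|Z'\|_{\infty,I},\|R^Z\|_{2\alpha,I},\|Z'\|_{\alpha,I}\}<\infty$. On $\mathbb R$ these are required on every compact interval. Rough path cocycle: random process $\mathbf X$ of rough paths on $\mathbb R$ with $X_{s,s+t}(\omega)=X_{0,t}(\theta_s\omega)$, $\mathbb X_{s,s+t}(\omega)=\mathbb X_{0,t}(\theta_s\omega)$ ($s\in\mathbb R,t\ge0$). $\mathbf X$-controlled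 rough path cocycle: random process $\mathbf Z=(Z,Z')$ with values in $U\times\mathcal L(V,U)$, $\mathbf Z(\omega)$ being $\mathbf X(\omega)$-controlled, $Z_{s,s+t}(\omega)=Z_{0,t}(\theta_s\omega)$, $Z'_{s+t}(\omega)=Z'_t(\theta_s\omega)$. Solution cocycle: for $y\in W$ let $(Y,Y')$ be the unique $\mathbf X(\omega)$-controlled path with $Y_t=y+\int_0^tF(Y_r)\,d\mathbf Z_r(\omega)+\int_0^tF_0(Y_r)\,dr$, $Y'_t=F(Y_t)Z'_t(\omega)$, where $\int F(Y)\,d\mathbf Z:=\lim\sum_{[u,v]}(F(Y_u)Z_{u,v}+DF(Y_u)Y'_uZ'_u\mathbb X_{u,v})$. Put $\phi_t^\omega(y):=(Y_t,Y'_t)$; $y$ is associated with the state $(y,F(y)Z'_0(\omega))$, and for $(y,y')\in W\times\mathcal L(V,W)$, $\phi_t^\omega(y,y'):=\phi_t^\omega(y)$. $D_{z_0}\phi_t^\omega$ is the Fréchet derivative at $z_0$; norms on $W\times\mathcal L(V,W)$ are a fixed product norm. As a standing assumption, $\phi_t^\omega$ is of class $C^1$. *)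

(* Defs.v *)
From HB Require Import structures.
From mathcomp Require Import all_boot all_order all_algebra.
From mathcomp Require Import all_classical all_reals all_analysis.
Import Order.TTheory GRing.Theory Num.Theory.
Import numFieldNormedType.Exports.
Set Implicit Arguments.
Unset Strict Implicit.
Unset Printing Implicit Defensive.
Local Open Scope classical_set_scope.
Local Open Scope ring_scope.

(* Finite-dimensional normed spaces; over a realType these are exactly the
   finite-dimensional Banach spaces. *)
#[short(type="finNormedModType")]
HB.structure Definition FinNormedModule (R : numDomainType) :=
  {E of NormedModule R E & Vector R E}.

HB.instance Definition _ (R : realType) (E G : finNormedModType R) :=
  NormedModule.on (E * G)%type.

(* 'Hom(E, G), with the operator norm, is the Banach space L(E, G). The
   bounds below serve only to check that the operator norm is a norm. *)
Section OperatorNorm.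
Import VectorInternalTheory.
Context {R : realType} {E G : finNormedModType R}.
Implicit Types f g : 'Hom(E, G).

Lemma rV_linear_bounded n (H : normedModType R) (h : {linear 'rV[R]_n -> H}) :
  exists2 C : R, 0 <= C & forall u, `|h u| <= C * `|u|.
Proof.
exists (\sum_i `|h (delta_mx 0 i)|); first exact: sumr_ge0.
move=> u; rewrite {1}(row_sum_delta u) linear_sum /= mulr_suml.
apply: le_trans (ler_norm_sum _ _ _) _; apply: ler_sum => i _.
rewrite linearZ normrZ mulrC ler_wpM2l//.
rewrite [leRHS]/Num.norm/= mx_normrE; apply/bigmax_geP; right => /=.
by exists (ord0, i).
Qed.

Lemma v2r_bounded : exists2 C : R, 0 <= C & forall x : E, `|v2r x| <= C * `|x|.
Proof.
pose h : {linear 'rV[R]_(dim E) -> E} := r2v.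
have [C C0 hC] := rV_linear_bounded h.
have hcont : continuous h.
  apply: bounded_linear_continuous; apply/linear_boundedP.
  by near=> r => x; apply: le_trans (hC x) _; rewrite ler_wpM2r.
pose S : set 'rV[R]_(dim E) := [set u | `|u| = 1].
have [S0|/set0P SN0] := eqVneq S set0.
  exists 0 => // x; rewrite mul0r normr_le0.
  apply/eqP; apply: contrapT => /eqP x0.
  suff : S (`|v2r x|^-1 *: v2r x) by rewrite S0.
  by rewrite /S /= normrZ normfV normr_id mulVf ?normr_eq0.
have cS : compact S.
  apply: bounded_closed_compact.
    by exists 1; split => // M M1 u /= ->; exact: ltW.
  rewrite (_ : S = (fun u : 'rV[R]_(dim E) => `|u|) @^-1` [set 1])//.
  apply: (@closed_comp _ _ (fun u : 'rV[R]_(dim E) => `|u|)); last first.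
    by apply: accessible_closed_set1; apply: hausdorff_accessible; exact: norm_hausdorff.
  by move=> u _; exact: norm_continuous.
have [|c Sc cmin] := @compact_EVT_min _ R (fun u => `|h u|) S SN0 cS.
  apply: continuous_subspaceT => u.
  by apply: continuous_comp; [exact: hcont|exact: norm_continuous].
have hc0 : 0 < `|h c|.
  rewrite normr_gt0; apply/eqP => hc.
  move: Sc; rewrite inE /S /= -[c]r2vK -/(h c) hc linear0 normr0 => /eqP.
  by rewrite eq_sym oner_eq0.
exists `|h c|^-1 => [|x]; first by rewrite invr_ge0.
have [->|x0] := eqVneq x 0; first by rewrite linear0 !normr0 mulr0.
have nx0 : 0 < `|v2r x| by rewrite normr_gt0 -(inj_eq (can_inj v2rK)) linear0 in x0 *.
have := cmin (`|v2r x|^-1 *: v2r x).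
rewrite inE /S /= normrZ normfV normr_id mulVf ?gt_eqF// => /(_ erefl).
rewrite /h linearZ/= v2rK normrZ normfV normr_id.
by rewrite ler_pdivlMl// => hcx; rewrite ler_pdivlMl// mulrC.
Unshelve. all: by end_near. Qed.

Lemma lfun_bounded f : exists2 C : R, 0 <= C & forall x, `|f x| <= C * `|x|.
Proof.
have [C C0 hC] := v2r_bounded.
have [D D0 hD] := rV_linear_bounded ((f : {linear E -> G}) \o (r2v : {linear 'rV[R]_(dim E) -> E})).
exists (D * C) => [|x]; first exact: mulr_ge0.
rewrite -{1}[x]v2rK -mulrA; apply: le_trans (hD _) _.
exact: ler_wpM2l.
Qed.

Definition opnorm f : R := sup [set `|f x| | x in [set x | `|x| <= 1]].

Lemma opnorm_has_sup f : has_sup [set `|f x| | x in [set x | `|x| <= 1]].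
Proof.
have [C C0 hC] := lfun_bounded f; split.
  by exists 0; exists 0; rewrite /= ?normr0 ?linear0 ?normr0.
exists C => _ [x /= x1 <-]; apply: le_trans (hC x) _.
by rewrite ler_piMr.
Qed.

Lemma opnorm_ge0 f : 0 <= opnorm f.
Proof.
apply: ub_le_sup; first exact: (opnorm_has_sup f).2.
by exists 0; rewrite /= ?normr0 ?linear0 ?normr0.
Qed.

Lemma opnormP f x : `|f x| <= opnorm f * `|x|.
Proof.
have [->|x0] := eqVneq x 0; first by rewrite linear0 !normr0 mulr0.
have nx0 : 0 < `|x| by rewrite normr_gt0.
rewrite -ler_pdivrMr//; apply: ub_le_sup; first exact: (opnorm_has_sup f).2.
exists (`|x|^-1 *: x); first by rewrite /= normrZ normfV normr_id mulVf ?gt_eqF.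
by rewrite linearZ normrZ normfV normr_id mulrC.
Qed.

Lemma opnorm_le f (C : R) :
  (forall x, `|x| <= 1 -> `|f x| <= C) -> opnorm f <= C.
Proof.
move=> hC; apply: ge_sup; first exact: (opnorm_has_sup f).1.
by move=> _ [x /= x1 <-]; exact: hC.
Qed.

Lemma opnormD f g : opnorm (f + g) <= opnorm f + opnorm g.
Proof.
apply: opnorm_le => x x1; rewrite add_lfunE.
apply: le_trans (ler_normD _ _) _; rewrite lerD//.
  by apply: le_trans (opnormP _ _) _; rewrite ler_piMr ?opnorm_ge0.
by apply: le_trans (opnormP _ _) _; rewrite ler_piMr ?opnorm_ge0.
Qed.

Lemma opnormZ_le (a : R) f : opnorm (a *: f) <= `|a| * opnorm f.
Proof.
apply: opnorm_le => x x1; rewrite scale_lfunE normrZ ler_wpM2l//.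
by apply: le_trans (opnormP _ _) _; rewrite ler_piMr ?opnorm_ge0.
Qed.

Lemma opnormZ (a : R) f : opnorm (a *: f) = `|a| * opnorm f.
Proof.
apply/eqP; rewrite eq_le opnormZ_le/=.
have [->|a0] := eqVneq a 0; first by rewrite normr0 mul0r opnorm_ge0.
rewrite -ler_pdivlMl ?normr_gt0// -normfV.
by rewrite -{1}[f]scale1r -(mulVf a0) -scalerA opnormZ_le.
Qed.

Lemma opnorm0_eq0 f : opnorm f = 0 -> f = 0.
Proof.
move=> f0; apply/lfunP => x; rewrite zero_lfunE; apply/eqP.
by rewrite -normr_le0; have := opnormP f x; rewrite f0 mul0r.
Qed.

HB.instance Definition _ :=
  Lmodule_isNormed.Build R 'Hom(E, G) opnormD opnormZ opnorm0_eq0.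

End OperatorNorm.

Section Smoothness.
Context {R : realType} {W : finNormedModType R}.

Definition Frechet {E : finNormedModType R} (f : W -> E) (x : W) : 'Hom(W, E) :=
  linfun ('d f x).

Definition classC1 {E : finNormedModType R} (f : W -> E) : Prop :=
  (forall x, differentiable f x) /\ continuous (Frechet f).

Definition bounded_map {E : finNormedModType R} (f : W -> E) : Prop :=
  exists M : R, forall x, `|f x| <= M.

(* f is k times continuously differentiable and its derivatives of order
   0, ..., k are bounded; order 0 means that f itself is bounded. *)
Fixpoint classCb (k : nat) {E : finNormedModType R} (f : W -> E) : Prop :=
  match k with
  | 0 => continuous f /\ bounded_map f
  | k'.+1 => [/\ forall x, differentiable f x, bounded_map f
                & classCb k' (Frechet f)]
  end.

End Smoothness.

Section TensorProduct.
Context {R : realType} {V VV : finNormedModType R}.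

(* VV together with tens is V (x) V, with an arbitrary norm. *)
Definition is_tensor_product (tens : {bilinear V -> V -> VV}) : Prop :=
  forall (E : vectType R) (B : {bilinear V -> V -> E}),
    exists! l : 'Hom(VV, E), forall v w, l (tens v w) = B v w.

(* The linear map on V (x) V induced by a bilinear map B on V x V. *)
Definition tensor_lift (tens : {bilinear V -> V -> VV})
    {E : finNormedModType R} (B : V -> V -> E) : 'Hom(VV, E) :=
  get [set l : 'Hom(VV, E) | forall v w, l (tens v w) = B v w].

End TensorProduct.

Section RoughPaths.
Context {R : realType} {V VV : finNormedModType R}.
Implicit Types (alpha : R) (I : set R).

Definition increment {E : finNormedModType R} (Y : R -> E) (s t : R) : E :=
  Y t - Y s.

Definition sup_norm {E : finNormedModType R} I (Y : R -> E) : \bar R :=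
  ereal_sup [set `|Y t|%:E | t in I].

Definition hoelder_seminorm {E : finNormedModType R} (gamma : R) I (A : R -> R -> E) :
    \bar R :=
  ereal_sup [set (`|A p.1 p.2| / (p.2 - p.1) `^ gamma)%:E |
    p in [set p : R * R | [/\ I p.1, I p.2 & p.1 < p.2]]].

Definition rough_norm alpha I (X : R -> V) (XX : R -> R -> VV) : \bar R :=
  maxe (hoelder_seminorm alpha I (increment X)) (hoelder_seminorm (2 * alpha) I XX `^ 2^-1)%E.

Record is_rough_path alpha (tens : {bilinear V -> V -> VV}) I
    (X : R -> V) (XX : R -> R -> VV) : Prop := IsRoughPath {
  rough_chen : forall s u t, I s -> I u -> I t -> s <= u -> u <= t ->
    XX s t = XX s u + XX u t + tens (increment X s u) (increment X u t);
  rough_finite : (rough_norm alpha I X XX < +oo)%E }.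

Definition remainder {E : finNormedModType R} (X : R -> V)
    (Z : R -> E) (Z' : R -> 'Hom(V, E)) (s t : R) : E :=
  increment Z s t - Z' s (increment X s t).

Definition controlled_norm {E : finNormedModType R} alpha I (X : R -> V)
    (Z : R -> E) (Z' : R -> 'Hom(V, E)) : \bar R :=
  maxe (maxe (sup_norm I Z) (sup_norm I Z'))
       (maxe (hoelder_seminorm (2 * alpha) I (remainder X Z Z'))
             (hoelder_seminorm alpha I (increment Z'))).

Definition is_controlled {E : finNormedModType R} alpha I (X : R -> V)
    (Z : R -> E) (Z' : R -> 'Hom(V, E)) : Prop :=
  (controlled_norm alpha I X Z Z' < +oo)%E.

End RoughPaths.

Section Cocycles.
Context {R : realType} {d : measure_display} {Omega : measurableType d}.

Record is_metric_dynamical_system (P : probability Omega R)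
    (theta : R -> Omega -> Omega) : Prop := IsMetricDynamicalSystem {
  mds_measurable :
    measurable_fun [set: R * Omega] (fun p : R * Omega => theta p.1 p.2);
  mds_0 : forall omega, theta 0 omega = omega;
  mds_add : forall s t omega, theta (s + t) omega = theta s (theta t omega);
  mds_preserving : forall t (A : set Omega), measurable A ->
    P (theta t @^-1` A) = P A }.

Definition borel_measurable {E : finNormedModType R} (f : Omega -> E) : Prop :=
  measurable_fun [set: Omega] (f : Omega -> g_sigma_algebraType (@open E)).

Context {V VV : finNormedModType R}.

Record is_rough_path_cocycle (theta : R -> Omega -> Omega) (alpha : R)
    (tens : {bilinear V -> V -> VV})
    (X : Omega -> R -> V) (XX : Omega -> R -> R -> VV) : Prop :=
  IsRoughPathCocycle {
  rpc_measurable1 : forall t, borel_measurable (X ^~ t);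
  rpc_measurable2 : forall s t, borel_measurable (fun omega => XX omega s t);
  rpc_rough : forall omega a b, a < b ->
    is_rough_path alpha tens `[a, b]%classic (X omega) (XX omega);
  rpc_cocycle1 : forall omega s t, 0 <= t ->
    increment (X omega) s (s + t) = increment (X (theta s omega)) 0 t;
  rpc_cocycle2 : forall omega s t, 0 <= t ->
    XX omega s (s + t) = XX (theta s omega) 0 t }.

Record is_controlled_cocycle {U : finNormedModType R}
    (theta : R -> Omega -> Omega) (alpha : R) (X : Omega -> R -> V)
    (Z : Omega -> R -> U) (Z' : Omega -> R -> 'Hom(V, U)) : Prop :=
  IsControlledCocycle {
  cc_measurable1 : forall t, borel_measurable (Z ^~ t);
  cc_measurable2 : forall t, borel_measurable (Z' ^~ t);
  cc_controlled : forall omega a b, a < b ->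
    is_controlled alpha `[a, b]%classic (X omega) (Z omega) (Z' omega);
  cc_cocycle1 : forall omega s t, 0 <= t ->
    increment (Z omega) s (s + t) = increment (Z (theta s omega)) 0 t;
  cc_cocycle2 : forall omega s t, 0 <= t ->
    Z' omega (s + t) = Z' (theta s omega) t }.

End Cocycles.

Section Integrals.
Context {R : realType} {E : finNormedModType R}.

(* J is the limit of the sums of A u v over the intervals [u, v] of a partition
   a :: s of [a, b], as the mesh of the partition tends to 0. *)
Definition is_partition_limit (a b : R) (A : R -> R -> E) (J : E) : Prop :=
  forall eps : R, 0 < eps -> exists2 delta : R, 0 < delta &
    forall s : seq R, itv_partition a b s ->
      let u := nth b (a :: s) in
      (forall n, (n < size s)%N -> u n.+1 - u n < delta) ->
      `|\sum_(0 <= n < size s) A (u n) (u n.+1) - J| < eps.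

(* The integral of an E-valued function, taken coordinatewise. *)
Definition vintegral (D : set R) (f : R -> E) : E :=
  let e := vbasis {:E} in
  \sum_(i < \dim {:E})
    (\int[lebesgue_measure]_(r in D) coord e i (f r)) *: e`_i.

End Integrals.

Section Solutions.
Context {R : realType} {U V VV W : finNormedModType R}.
Variables (alpha : R) (tens : {bilinear V -> V -> VV}).
Variables (F : W -> 'Hom(U, W)) (F0 : W -> W).

(* The summand F(Y_u) Z_{u,v} + DF(Y_u) Y'_u Z'_u XX_{u,v}; the first leg of
   XX_{u,v} is fed to DF(Y_u) Y'_u and the second one to Z'_u. *)
Definition rough_germ (XX : R -> R -> VV) (Z : R -> U) (Z' : R -> 'Hom(V, U))
    (Y : R -> W) (Y' : R -> 'Hom(V, W)) (u v : R) : W :=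
  F (Y u) (increment Z u v) +
  tensor_lift tens (fun v1 v2 => Frechet F (Y u) (Y' u v1) (Z' u v2)) (XX u v).

Record is_solution (X : R -> V) (XX : R -> R -> VV)
    (Z : R -> U) (Z' : R -> 'Hom(V, U)) (y : W)
    (Y : R -> W) (Y' : R -> 'Hom(V, W)) : Prop := IsSolution {
  sol_controlled : forall T, 0 < T ->
    is_controlled alpha `[0, T]%classic X Y Y';
  sol_equation : forall t, 0 <= t -> exists2 J : W,
    is_partition_limit 0 t (rough_germ XX Z Z' Y Y') J &
    Y t = y + J + vintegral `[0, t]%classic (F0 \o Y);
  sol_derivative : forall t, 0 <= t -> Y' t = (F (Y t) \o Z' t)%VF }.

(* phi t omega y = (Y_t, Y'_t) for t >= 0; the values of phi for t < 0 are
   irrelevant. *)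
Definition is_solution_cocycle {Omega : Type}
    (X : Omega -> R -> V) (XX : Omega -> R -> R -> VV)
    (Z : Omega -> R -> U) (Z' : Omega -> R -> 'Hom(V, U))
    (phi : R -> Omega -> W -> W * 'Hom(V, W)) : Prop :=
  forall omega y,
    let solves := is_solution (X omega) (XX omega) (Z omega) (Z' omega) y in
    solves (fun t => (phi t omega y).1) (fun t => (phi t omega y).2) /\
    forall Y Y', solves Y Y' ->
      forall t, 0 <= t -> (Y t, Y' t) = phi t omega y.

Definition on_states {Omega : Type}
    (phi : R -> Omega -> W -> W * 'Hom(V, W)) (t : R) (omega : Omega)
    (z : W * 'Hom(V, W)) : W * 'Hom(V, W) :=
  phi t omega z.1.

End Solutions.

Section Growth.
Context {R : realType}.

Definition logp (x : R) : R := Num.max (ln x) 0.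

Record increasing_polynomial_type (Q : R -> R -> R -> R) : Prop :=
  IncreasingPolynomialType {
  ipt_mono1 : forall x x' y z, 0 <= x -> 0 <= y -> 0 <= z ->
    x <= x' -> Q x y z <= Q x' y z;
  ipt_mono2 : forall x y y' z, 0 <= x -> 0 <= y -> 0 <= z ->
    y <= y' -> Q x y z <= Q x y' z;
  ipt_mono3 : forall x y z z', 0 <= x -> 0 <= y -> 0 <= z ->
    z <= z' -> Q x y z <= Q x y z';
  ipt_growth : exists (C : R) (n : nat), forall x y z,
    0 <= x -> 0 <= y -> 0 <= z -> `|Q x y z| <= C * (1 + x + y + z) ^+ n }.

End Growth.

(* Main.v *)
Require Import Defs.
From HB Require Import structures.
From mathcomp Require Import all_boot all_order all_algebra.
From mathcomp Require Import all_classical all_reals all_analysis.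
From mathcomp Require Import ring lra.
Import Order.TTheory GRing.Theory Num.Theory.
Import numFieldNormedType.Exports.
Local Open Scope classical_set_scope.
Local Open Scope ring_scope.

(** The state at time t is globally Lipschitz in the initial state, with constant
    L^2 2^n where L and n are polynomial in the norms of the driver. The
    derivative of a differentiable map is bounded by its Lipschitz constant, so
    the logarithm of the derivative is bounded by a polynomial.

    Only differences of two solutions Y and Y2 driven by the same omega are
    estimated; no equation for the derivative of the flow is derived. Write
    w = |t - s|^alpha. Let A_{s,t} be the germ of the rough integral, that is
    F(Y_s) Z_{s,t} plus the second-order term in XX_{s,t}. Chen's relation makes
    A_{u,v} - A_{u,m} - A_{m,v} of order w^3, and 3 alpha > 1, so summing this
    defect along dyadic partitions compares the integral over [s, t] with
    A_{s,t} up to w^3 (lemma sewing).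

    This is used twice on a short interval. For one solution it bounds the
    remainder R_{s,t} = Y_{s,t} - F(Y_s) Z'_s X_{s,t} by a constant plus half of
    any bound already known, hence by about twice that constant (apriori); the
    bound is uniform in the initial value because F is bounded. For the
    difference of two solutions the defect is linear in sup |Y2 - Y| and in the
    difference of the remainders, thanks to second-difference estimates on F and
    DF, which is what the three bounded derivatives of F provide. This gives
    |Y2_s - Y_s| <= 2 |Y2_a - Y_a| on [a, b] (local_lipschitz). The interval has
    to satisfy K (b - a)^alpha <= 1 with K polynomial in the norms; as
    alpha > 1/3, the length K^(-3) is allowed, and [0, T] is covered by about
    T K^3 such intervals (global_lipschitz).

    All constants are absorbed into a single L >= 1, a multiple of
    (1 + |Z| + |X|)^2; the square is there because the norm of a rough path
    contains the square root of the Hoelder seminorm of the area. *)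

Set Implicit Arguments.
Unset Strict Implicit.
Unset Printing Implicit Defensive.

(** * Coordinates and the mean value inequality *)

Section Coordinates.
Import VectorInternalTheory.
Context {R : realType}.

Lemma linear_bounded (E : finNormedModType R) (H : normedModType R)
    (h : {linear E -> H}) : exists2 C : R, 0 <= C & forall x, `|h x| <= C * `|x|.
Proof.
have [C C0 vC] := @v2r_bounded R E.
have [D D0 hD] := rV_linear_bounded (h \o (r2v : {linear 'rV[R]_(dim E) -> E})).
exists (D * C) => [|x]; first exact: mulr_ge0.
have := hD (v2r x); rewrite /= v2rK => /le_trans; apply.
by rewrite -mulrA ler_wpM2l.
Qed.

Lemma coord_bounded (E : finNormedModType R) : exists2 C : R, 0 <= C &
  forall (x : E) i, `|coord (vbasis {:E}) i x| <= C * `|x|.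
Proof.
have /choice[D DP] : forall i, exists D : R, 0 <= D /\
    forall x : E, `|coord (vbasis {:E}) i x| <= D * `|x|.
  move=> i; pose l : {linear E -> R^o} := coord (vbasis {:E}) i.
  by have [D D0 hD] := linear_bounded l; exists D.
exists (\sum_i D i) => [|x i]; first by rewrite sumr_ge0// => i _; case: (DP i).
apply: le_trans ((DP i).2 x) _; rewrite ler_wpM2r//.
by rewrite (bigD1 i)//= lerDl sumr_ge0// => j _; case: (DP j).
Qed.

Lemma norm_le_coord (E : finNormedModType R) : exists2 C : R, 0 <= C &
  forall (x : E) M, (forall i, `|coord (vbasis {:E}) i x| <= M) -> `|x| <= C * M.
Proof.
exists (\sum_(i < \dim {:E}) `|(vbasis {:E})`_i|) => [|x M xM]; first exact: sumr_ge0.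
rewrite {1}(coord_vbasis (memvf x)) mulr_suml.
apply: le_trans (ler_norm_sum _ _ _) _; apply: ler_sum => i _.
by rewrite normrZ mulrC ler_wpM2l.
Qed.

Definition mean_value_constant (E : finNormedModType R) (C : R) : Prop :=
  0 <= C /\ forall (g dg : R -> E) (M : R),
    (forall t : R, is_derive t 1 g (dg t)) ->
    (forall t : R, 0 <= t <= 1 -> `|dg t| <= M) -> `|g 1 - g 0| <= C * M.

(** The scalar mean value theorem in each coordinate; passing to coordinates
    and back costs a constant that depends on E only. *)
Lemma mean_value_constant_ex (E : finNormedModType R) :
  exists C, mean_value_constant E C.
Proof.
have [C C0 hC] := coord_bounded E; have [D D0 hD] := norm_le_coord E.
exists (D * C); split=> [|g dg M gdg dgM]; first exact: mulr_ge0.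
rewrite -mulrA; apply: hD => i.
pose l : {linear E -> R^o} := coord (vbasis {:E}) i.
have lcont : continuous l.
  apply: bounded_linear_continuous; apply/linear_boundedP.
  by near=> r => x; apply: le_trans (hC x i) _; rewrite ler_wpM2r.
have lg (t : R) : is_derive t 1 (l \o g : R -> R) (l (dg t)).
  have cvgl : h^-1 *: ((l \o g) (h *: 1 + t) - (l \o g) t) @[h --> 0^'] --> l (dg t).
    have [dgt <-] := gdg t.
    have -> : (fun h : R => h^-1 *: ((l \o g) (h *: 1 + t) - (l \o g) t)) =
        l \o (fun h : R => h^-1 *: ((g \o shift t) (h *: 1) - g t)).
      apply: funext => h /=; rewrite scalerBr [in RHS]scalerBr [RHS](raddfB l).
      by congr (_ - _); exact/esym/(linearZ_LR l).
    by apply: continuous_cvg; [exact: lcont|exact: dgt].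
  apply: DeriveDef; last exact: cvg_lim.
  by apply/cvg_ex; exists (l (dg t)).
have lgc : continuous (l \o g : R -> R).
  by move=> t; apply: differentiable_continuous; apply/derivable1_diffP; case: (lg t).
have [c c01] := MVT_segment ler01 (fun x _ => lg x) (continuous_subspaceT lgc).
rewrite subr0 mulr1 linearB => ->.
apply: le_trans (hC _ _) _; by rewrite ler_wpM2l// dgM.
Unshelve. all: by end_near. Qed.

End Coordinates.


Section VectorIdentities.
Context {R : realType} {E : finNormedModType R}.

Lemma coord_ext (x y : E) :
  (forall i, coord (vbasis {:E}) i x = coord (vbasis {:E}) i y) -> x = y.
Proof.
move=> xy; rewrite (coord_vbasis (memvf x)) (coord_vbasis (memvf y)).
by apply: eq_bigr => i _; rewrite xy.
Qed.

Variable i : 'I_(\dim {:E}).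
Implicit Types x y : E.

Lemma coord_add x y : coord (vbasis {:E}) i (x + y) =
  coord (vbasis {:E}) i x + coord (vbasis {:E}) i y.
Proof. exact: raddfD. Qed.

Lemma coord_opp x : coord (vbasis {:E}) i (- x) = - coord (vbasis {:E}) i x.
Proof. exact: raddfN. Qed.

Lemma coord_scale (c : R) x :
  coord (vbasis {:E}) i (c *: x) = c * coord (vbasis {:E}) i x.
Proof. exact: linearZ. Qed.

Lemma coord_zero : coord (vbasis {:E}) i (0 : E) = 0.
Proof. exact: raddf0. Qed.

End VectorIdentities.

(** Decides linear identities in a finite-dimensional space, coordinate by
    coordinate. *)
Ltac vring := apply: coord_ext => ?;
  rewrite ?(coord_add, coord_opp, coord_scale, coord_zero); ring.

Section LineDerivative.
Context {R : realType} {W E : finNormedModType R}.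

Lemma FrechetE (G : W -> E) x v : differentiable G x -> Frechet G x v = 'd G x v.
Proof. by move=> _; rewrite /Frechet lfunE. Qed.

Lemma is_derive_line (G : W -> E) (p a : W) (t : R) :
  (forall x, differentiable G x) ->
  is_derive t 1 (fun s : R => G (p + s *: a)) (Frechet G (p + t *: a) a).
Proof.
move=> dG; rewrite FrechetE//.
have dl : is_diff t (cst p + *:%R ^~ a : R -> W) (0 + *:%R ^~ a) by exact: is_diffD.
have dGl : is_diff ((cst p + *:%R ^~ a : R -> W) t) G ('d G (p + t *: a)).
  exact: differentiableP.
have [d1 d2] := is_diff_comp dl dGl.
apply: DeriveDef; first exact/derivable1_diffP.
by rewrite (deriveE _ d1) d2 /= add0r scale1r.
Qed.

End LineDerivative.

(** * Taylor estimates of first and second order *)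

Lemma lfun_norm_le {R : realType} {E G : finNormedModType R} (f : 'Hom(E, G)) x :
  `|f x| <= `|f| * `|x|.
Proof. exact: opnormP. Qed.

Section TaylorBounds.
Context {R : realType} {W E : finNormedModType R}.

Definition lipschitz_with (B : R) (G : W -> E) : Prop :=
  forall p q, `|G q - G p| <= B * `|q - p|.

(** A bound that vanishes with the distance of the segments [p, p'] and
    [q, q'], and is linear in p' - p and (q' - q) - (p' - p). With (p, p') and
    (q, q') the values of two solutions at two times, it is linear in the
    difference of the solutions. *)
Definition second_difference_bound (B : R) (G : W -> E) : Prop :=
  forall p p' q q', `|(G q' - G q) - (G p' - G p)| <=
    B * (`|(q' - q) - (p' - p)| + (`|q - p| + `|q' - p'|) * `|p' - p|).

Definition taylor_remainder (G : W -> E) (DG : W -> 'Hom(W, E)) (y w : W) : E :=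
  G (y + w) - G y - DG y w.

(** The analogue of second_difference_bound for Taylor remainders: quadratically
    small in the increments, and linear in w' - w and y' - y. *)
Definition remainder_difference_bound (B : R) (G : W -> E)
    (DG : W -> 'Hom(W, E)) : Prop :=
  forall y y' w w', `|taylor_remainder G DG y' w' - taylor_remainder G DG y w| <=
    B * ((`|w| + `|w'|) * (`|w' - w| + `|w| * `|y' - y|)).

Lemma lipschitz_withW B B' G : B <= B' -> lipschitz_with B G -> lipschitz_with B' G.
Proof. by move=> BB' lipG p q; apply: le_trans (lipG p q) _; rewrite ler_wpM2r. Qed.

Lemma second_difference_boundW B B' G : B <= B' ->
  second_difference_bound B G -> second_difference_bound B' G.
Proof.
move=> BB' sdG p p' q q'; apply: le_trans (sdG p p' q q') _.
by rewrite ler_wpM2r// addr_ge0// mulr_ge0// addr_ge0.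
Qed.

Lemma remainder_difference_boundW B B' G DG : B <= B' ->
  remainder_difference_bound B G DG -> remainder_difference_bound B' G DG.
Proof.
move=> BB' rdG y y' w w'; apply: le_trans (rdG y y' w w') _.
by rewrite ler_wpM2r// mulr_ge0 ?addr_ge0// mulr_ge0.
Qed.

(** The usual quadratic bound is the comparison with a zero increment. *)
Lemma remainder_quadratic B G DG : remainder_difference_bound B G DG ->
  forall y w, `|taylor_remainder G DG y w| <= B * `|w| ^+ 2.
Proof.
move=> rdG y w; have := rdG y y 0 w; rewrite /taylor_remainder.
by rewrite addr0 linear0 !subrr !subr0 normr0 mul0r addr0 add0r expr2.
Qed.

End TaylorBounds.

Section TaylorEstimates.
Context {R : realType} {W E : finNormedModType R}.
Variables (C : R) (mvC : mean_value_constant E C).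

Lemma lipschitz_of_Frechet (M : R) (G : W -> E) :
  (forall x, differentiable G x) -> (forall x, `|Frechet G x| <= M) ->
  lipschitz_with (C * M) G.
Proof.
move=> dG GM p q; rewrite -mulrA.
have := mvC.2 _ _ (M * `|q - p|) (fun t => is_derive_line p (q - p) t dG).
rewrite /= scale1r scale0r addr0 subrKC; apply=> t _.
by apply: le_trans (lfun_norm_le _ _) _; rewrite ler_wpM2r.
Qed.

Lemma segment_distance (p p' q q' : W) (t : R) : 0 <= t <= 1 ->
  `|q + t *: (q' - q) - (p + t *: (p' - p))| <= `|q - p| + `|q' - p'|.
Proof.
move=> /andP[t0 t1].
have -> : q + t *: (q' - q) - (p + t *: (p' - p)) =
    (1 - t) *: (q - p) + t *: (q' - p').
  by vring.
apply: le_trans (ler_normD _ _) _; rewrite !normrZ.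
by rewrite lerD// ler_piMl// ger0_norm ?subr_ge0// lerBlDr lerDl.
Qed.

Lemma second_difference_of_Frechet (M : R) (G : W -> E) :
  (forall x, differentiable G x) -> (forall x, `|Frechet G x| <= M) ->
  lipschitz_with M (Frechet G) -> second_difference_bound (C * M) G.
Proof.
(* mean value inequality for t |-> G (q + t (q' - q)) - G (p + t (p' - p)) *)
move=> dG GM lipG p p' q q'; rewrite -mulrA.
have M0 : 0 <= M by exact: le_trans (GM 0).
have := mvC.2 _ _ (M * (`|(q' - q) - (p' - p)| + (`|q - p| + `|q' - p'|) * `|p' - p|))
  (fun t => is_deriveB (is_derive_line q (q' - q) t dG) (is_derive_line p (p' - p) t dG)).
rewrite !fctE /= !scale1r !scale0r !addr0 !subrKC.
rewrite (_ : G q' - G p' - (G q - G p) = G q' - G q - (G p' - G p)); last first.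
  by vring.
apply=> t t01.
set Dq := Frechet G _; set Dp := Frechet G (p + _).
have -> : Dq (q' - q) - Dp (p' - p) = Dq (q' - q - (p' - p)) + (Dq - Dp) (p' - p).
  by rewrite linearB !(add_lfunE, opp_lfunE) /=; vring.
apply: le_trans (ler_normD _ _) _; rewrite mulrDr lerD//.
  by apply: le_trans (lfun_norm_le _ _) _; rewrite ler_wpM2r ?GM.
rewrite mulrA; apply: le_trans (lfun_norm_le _ _) _; rewrite ler_wpM2r//.
apply: le_trans (lipG _ _) _; rewrite ler_wpM2l//.
exact: segment_distance.
Qed.

Lemma is_derive_scalel (c : E) (t : R) : is_derive t 1 ( *:%R ^~ c : R -> E) c.
Proof.
have [d1 d2] := is_diff_scalel t c.
apply: DeriveDef; first exact/derivable1_diffP.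
by rewrite (deriveE _ d1) d2 scale1r.
Qed.

Lemma remainder_difference_of_Frechet (M : R) (G : W -> E) :
  (forall x, differentiable G x) -> 0 <= M ->
  lipschitz_with M (Frechet G) -> second_difference_bound M (Frechet G) ->
  remainder_difference_bound (C * M) G (Frechet G).
Proof.
(* mean value inequality for the difference of the functions
   t |-> G (y + t w) - t DG(y) w, whose derivative is a first difference of DG *)
move=> dG M0 lipG sdG y y' w w'; rewrite -mulrA.
have := mvC.2 _ _ (M * ((`|w| + `|w'|) * (`|w' - w| + `|w| * `|y' - y|)))
  (fun t => is_deriveB
   (is_deriveB (is_derive_line y' w' t dG) (is_derive_scalel (Frechet G y' w') t))
   (is_deriveB (is_derive_line y w t dG) (is_derive_scalel (Frechet G y w) t))).
rewrite !fctE /= !scale1r !scale0r !addr0 !subr0.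
rewrite /taylor_remainder.
have -> : (G (y' + w') - Frechet G y' w' - (G (y + w) - Frechet G y w) - (G y' - G y)) =
  (G (y' + w') - G y' - Frechet G y' w' - (G (y + w) - G y - Frechet G y w)).
  by vring.
apply=> t /andP[t0 t1].
set D1 := Frechet G (y' + _); set D2 := Frechet G (y + _).
have -> : D1 w' - Frechet G y' w' - (D2 w - Frechet G y w) =
   (D1 - Frechet G y') (w' - w) + ((D1 - D2) - (Frechet G y' - Frechet G y)) w.
  by rewrite linearB !(add_lfunE, opp_lfunE) /=; vring.
apply: le_trans (ler_normD _ _) _.
have h1 : `|(D1 - Frechet G y') (w' - w)| <= M * `|w'| * `|w' - w|.
  apply: le_trans (lfun_norm_le _ _) _; rewrite ler_wpM2r//.
  apply: le_trans (lipG _ _) _; rewrite ler_wpM2l// addrC addKr normrZ ger0_norm//.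
  by rewrite ler_piMl.
have h2 : `|((D1 - D2) - (Frechet G y' - Frechet G y)) w| <=
   M * (`|w' - w| + (`|w| + `|w'|) * `|y' - y|) * `|w|.
  apply: le_trans (lfun_norm_le _ _) _; rewrite ler_wpM2r//.
  apply: le_trans (sdG _ _ _ _) _; rewrite ler_wpM2l//.
  have -> : y' + t *: w' - (y + t *: w) - (y' - y) = t *: (w' - w).
    by vring.
  rewrite ![_ + t *: _]addrC !addrK !normrZ ger0_norm//.
  by rewrite lerD ?ler_piMl// ler_wpM2r// lerD// ler_piMl.
apply: le_trans (lerD h1 h2) _.
have := normr_ge0 w; have := normr_ge0 w'; have := normr_ge0 (w' - w); have := normr_ge0 (y' - y).
nra.
Qed.

End TaylorEstimates.

(** * Bounds on the vector fields *)

Section VectorFields.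
Context {R : realType} {U W : finNormedModType R}.

Record field_bounds (L : R) (F : W -> 'Hom(U, W))
    (DF : W -> 'Hom(W, 'Hom(U, W))) (F0 : W -> W) : Prop := FieldBounds {
  field_norm : forall y, `|F y| <= L;
  field_derivative_norm : forall y, `|DF y| <= L;
  field_lip : lipschitz_with L F;
  field_derivative_lip : lipschitz_with L DF;
  field_sd : second_difference_bound L F;
  field_derivative_sd : second_difference_bound L DF;
  field_rd : remainder_difference_bound L F DF;
  drift_norm : forall y, `|F0 y| <= L;
  drift_lip : lipschitz_with L F0 }.

Lemma field_bounds_ex (F : W -> 'Hom(U, W)) (F0 : W -> W) :
  classCb 3 F -> classCb 1 F0 ->
  exists L0, forall L, L0 <= L -> field_bounds L F (Frechet F) F0.
Proof.
move=> [dF [B0 FB] [dDF [B1 DFB] [dD2F [B2 D2FB] [_ [B3 D3FB]]]]].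
move=> [dF0 [B4 F0B] [_ [B5 DF0B]]].
have [C1 mv1] := mean_value_constant_ex 'Hom(U, W).
have [C2 mv2] := mean_value_constant_ex 'Hom(W, 'Hom(U, W)).
have [C3 mv3] := mean_value_constant_ex 'Hom(W, 'Hom(W, 'Hom(U, W))).
have [C4 mv4] := mean_value_constant_ex W.
have lF := lipschitz_of_Frechet mv1 dF DFB.
have lDF := lipschitz_of_Frechet mv2 dDF D2FB.
have lD2F := lipschitz_of_Frechet mv3 dD2F D3FB.
have lF0 := lipschitz_of_Frechet mv4 dF0 DF0B.
pose M1 := Num.max B1 (C2 * B2); pose M2 := Num.max B2 (C3 * B3).
have sF : second_difference_bound (C1 * M1) F.
  apply: second_difference_of_Frechet => // [x|].
    by apply: le_trans (DFB x) _; rewrite le_max lexx.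
  by apply: lipschitz_withW lDF; rewrite le_max lexx orbT.
have sDF : second_difference_bound (C2 * M2) (Frechet F).
  apply: second_difference_of_Frechet => // [x|].
    by apply: le_trans (D2FB x) _; rewrite le_max lexx.
  by apply: lipschitz_withW lD2F; rewrite le_max lexx orbT.
pose M3 := Num.max (C2 * B2) (C2 * M2).
have M3_ge0 : 0 <= M3.
  rewrite le_max; apply/orP; left; rewrite mulr_ge0//; first by case: mv2.
  exact: le_trans (D2FB 0).
have rF : remainder_difference_bound (C1 * M3) F (Frechet F).
  apply: remainder_difference_of_Frechet => //.
    by apply: lipschitz_withW lDF; rewrite le_max lexx.
  by apply: second_difference_boundW sDF; rewrite le_max lexx orbT.
pose s := [:: B0; B1; C1 * B1; C2 * B2; C1 * M1; C2 * M2; C1 * M3; B4; C4 * B5].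
exists (\big[Num.max/0]_(c <- s) c) => L sL.
have hL c : c \in s -> c <= L by move=> cs; apply: le_trans sL; exact: le_bigmax_seq.
split.
- by move=> y; apply: le_trans (FB y) _; rewrite hL// !inE eqxx ?orbT.
- by move=> y; apply: le_trans (DFB y) _; rewrite hL// !inE eqxx ?orbT.
- by apply: lipschitz_withW lF; rewrite hL// !inE eqxx ?orbT.
- by apply: lipschitz_withW lDF; rewrite hL// !inE eqxx ?orbT.
- by apply: second_difference_boundW sF; rewrite hL// !inE eqxx ?orbT.
- by apply: second_difference_boundW sDF; rewrite hL// !inE eqxx ?orbT.
- by apply: remainder_difference_boundW rF; rewrite hL// !inE eqxx ?orbT.
- by move=> y; apply: le_trans (F0B y) _; rewrite hL// !inE eqxx ?orbT.
- by apply: lipschitz_withW lF0; rewrite hL// !inE eqxx ?orbT.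
Qed.

Lemma lfun2_norm_le {E G H : finNormedModType R} (A : 'Hom(E, 'Hom(G, H))) x v :
  `|A x v| <= `|A| * `|x| * `|v|.
Proof.
apply: le_trans (lfun_norm_le _ _) _; rewrite ler_wpM2r//.
exact: lfun_norm_le.
Qed.

Variables (L : R) (F : W -> 'Hom(U, W)) (DF : W -> 'Hom(W, 'Hom(U, W))) (F0 : W -> W).
Hypothesis FB : field_bounds L F DF F0.

(** The bilinear form that is evaluated on the area in the second-order term of
    the germ, before composition with Z'. *)
Definition second_field (y : W) (x v : U) : W := DF y (F y x) v.

Let L_ge0 : 0 <= L.
Proof. exact: le_trans (field_norm FB 0). Qed.

Lemma field_le y x : `|F y x| <= L * `|x|.
Proof. by apply: le_trans (lfun_norm_le _ _) _; rewrite ler_wpM2r// (field_norm FB). Qed.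

Lemma field_derivative_le y w v : `|DF y w v| <= L * `|w| * `|v|.
Proof.
apply: le_trans (lfun2_norm_le _ _ _) _; rewrite !ler_wpM2r//.
exact: field_derivative_norm FB _.
Qed.

Lemma second_field_norm y x v : `|second_field y x v| <= L ^+ 2 * `|x| * `|v|.
Proof.
apply: le_trans (field_derivative_le _ _ _) _; rewrite expr2 -!mulrA ler_wpM2l// mulrA.
by rewrite ler_wpM2r// field_le.
Qed.

Lemma product_le {E G : finNormedModType R} (A : 'Hom(E, 'Hom(U, G)))
    (B : 'Hom(U, E)) (a b : R) x v : `|A| <= a -> `|B| <= b ->
  `|A (B x) v| <= a * b * (`|x| * `|v|).
Proof.
move=> Aa Bb; apply: le_trans (lfun2_norm_le _ _ _) _; rewrite mulrA ler_wpM2r//.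
rewrite -mulrA ler_pM//; apply: le_trans (lfun_norm_le _ _) _.
by rewrite ler_wpM2r.
Qed.

Lemma second_field_lip p q x v :
  `|second_field q x v - second_field p x v| <= 2 * L ^+ 2 * `|q - p| * (`|x| * `|v|).
Proof.
have -> : second_field q x v - second_field p x v =
    (DF q - DF p) (F q x) v + DF p ((F q - F p) x) v.
  rewrite /second_field !(add_lfunE, opp_lfunE) linearB !(add_lfunE, opp_lfunE).
  by vring.
apply: le_trans (ler_normD _ _) _.
have h1 := product_le x v (field_derivative_lip FB p q) (field_norm FB q).
have h2 := product_le x v (field_derivative_norm FB p) (field_lip FB p q).
by apply: le_trans (lerD h1 h2) _; rewrite le_eqVlt; apply/orP; left; apply/eqP; ring.
Qed.

Lemma second_field_sd p p' q q' x v :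
  `|(second_field q' x v - second_field q x v) -
    (second_field p' x v - second_field p x v)| <=
  3 * L ^+ 2 * (`|(q' - q) - (p' - p)| + (`|q - p| + `|q' - p'|) * `|p' - p|)
   * (`|x| * `|v|).
Proof.
(* The cross terms must be products of a difference between the segments with a
   difference along p' - p, hence the asymmetric splitting. *)
have -> : (second_field q' x v - second_field q x v) -
    (second_field p' x v - second_field p x v) =
  (((DF q' - DF q) - (DF p' - DF p)) (F q' x) v + 
  DF q (((F q' - F q) - (F p' - F p)) x) v) +
  ((DF q - DF p) ((F p' - F p) x) v + (DF p' - DF p) ((F q' - F p') x) v).
  rewrite /second_field !(add_lfunE, opp_lfunE).
  rewrite ?(linearB, linearD, linearN) !(add_lfunE, opp_lfunE).
  by vring.
have h1 := product_le x v (field_derivative_sd FB p p' q q') (field_norm FB q').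
have h2 := product_le x v (field_derivative_norm FB q) (field_sd FB p p' q q').
have h3 := product_le x v (field_derivative_lip FB p q) (field_lip FB p p').
have h4 := product_le x v (field_derivative_lip FB p p') (field_lip FB p' q').
apply: le_trans (ler_normD _ _) _.
apply: le_trans (lerD (ler_normD _ _) (ler_normD _ _)) _.
apply: le_trans (lerD (lerD h1 h2) (lerD h3 h4)) _.
have := mulr_ge0 (normr_ge0 x) (normr_ge0 v).
set N := `|x| * `|v| => N0.
have := normr_ge0 (q' - q - (p' - p)).
set e := `|_| => e0; set a := `|p' - p|; set b := `|q' - p'|; set c := `|q - p|.
rewrite -subr_ge0.
have -> : 3 * L ^+ 2 * (e + (c + b) * a) * N -
  (L * (e + (c + b) * a) * L * N + L * (L * (e + (c + b) * a)) * N +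
   (L * c * (L * a) * N + L * a * (L * b) * N)) = L ^+ 2 * e * N by ring.
by rewrite !mulr_ge0.
Qed.

End VectorFields.

(** * Evaluating bilinear maps on tensors *)

Section TensorEvaluation.
Context {R : realType} {V VV : finNormedModType R}.
Variable tens : {bilinear V -> V -> VV}.
Hypothesis tensP : is_tensor_product tens.

Let n := \dim {:V}.
Let e (i : 'I_n) : V := (vbasis {:V})`_i.
Let x_ (i : 'I_n) (v : V) : R := coord (vbasis {:V}) i v.

Definition bilinear_map {E : lmodType R} (B : V -> V -> E) : Prop :=
  (forall w, linear (B ^~ w)) /\ (forall v, linear (B v)).

Lemma bilinear_map_tens : bilinear_map tens.
Proof. by split=> [w|v] a x y; [exact: linearPl|exact: linearPr]. Qed.

Lemma bilinear_lift (E : vectType R) (B : V -> V -> E) : bilinear_map B ->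
  exists2 l : 'Hom(VV, E), (forall v w, l (tens v w) = B v w) &
    forall l' : 'Hom(VV, E), (forall v w, l' (tens v w) = B v w) -> l' = l.
Proof.
move=> [Bl Br].
pose bB := bilinear_isBilinear.Build R V V E *:%R *:%R B (Bl, Br).
pose B' : {bilinear V -> V -> E} := HB.pack B bB.
have [l [lB lU]] := @tensP E B'.
by exists l => // l' l'B; rewrite (lU l').
Qed.

Definition tensor_sum {E : lmodType R} (c : 'I_n -> 'I_n -> VV -> R)
    (B : V -> V -> E) (x : VV) : E :=
  \sum_i \sum_j c i j x *: B (e i) (e j).

Lemma bilinear_coord {E : lmodType R} (B : V -> V -> E) v w : bilinear_map B ->
  B v w = \sum_i \sum_j (x_ i v * x_ j w) *: B (e i) (e j).
Proof.
move=> [Bl Br].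
pose fl u : {linear V -> E} := HB.pack (B ^~ u) (GRing.isLinear.Build R V E _ (B ^~ u) (Bl u)).
pose fr u : {linear V -> E} := HB.pack (B u) (GRing.isLinear.Build R V E _ (B u) (Br u)).
rewrite {1}(coord_vbasis (memvf v)) -[LHS]/(fl w _) linear_sum.
apply: eq_bigr => i _; rewrite linearZ /=.
rewrite {1}(coord_vbasis (memvf w)) -[B _ _]/(fr (e i) _) linear_sum scaler_sumr.
by apply: eq_bigr => j _; rewrite linearZ /= scalerA.
Qed.

(** The coordinates are the lifts of the products of coordinates; they
    reassemble the identity because both are lifts of the tensor map itself. *)
Lemma tensor_coordinates : exists2 c : 'I_n -> 'I_n -> 'Hom(VV, R^o),
  (forall i j v w, c i j (tens v w) = x_ i v * x_ j w) &
  (forall x, x = tensor_sum (fun i j => c i j) tens x).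
Proof.
have bil_ij i j : bilinear_map (fun v w => x_ i v * x_ j w : R^o).
  split=> [w|v] a x y; rewrite /x_ linearP /=.
    by rewrite mulrDl -mulrA.
  by rewrite mulrDr mulrCA.
have /choice[c cP] : forall ij : 'I_n * 'I_n, exists l : 'Hom(VV, R^o),
    forall v w, l (tens v w) = x_ ij.1 v * x_ ij.2 w.
  by move=> [i j]; have [l lB _] := bilinear_lift (bil_ij i j); exists l.
exists (fun i j => c (i, j)) => [i j v w|x]; first exact: cP.
have [l lB lU] := bilinear_lift bilinear_map_tens.
have s_lin : linear (tensor_sum (fun i j => c (i, j)) tens).
  move=> a y z; rewrite /tensor_sum scaler_sumr -big_split /=; apply: eq_bigr => i _.
  rewrite scaler_sumr -big_split /=; apply: eq_bigr => j _.
  by rewrite linearP /= scalerDl scalerA.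
pose s : {linear VV -> VV} := HB.pack (tensor_sum (fun i j => c (i, j)) tens)
  (GRing.isLinear.Build R VV VV _ _ s_lin).
have -> : tensor_sum (fun i j => c (i, j)) tens x = linfun s x by rewrite lfunE.
rewrite (lU (linfun s)) => [|v w].
  by rewrite -(lU \1%VF) ?id_lfunE// => v w; rewrite id_lfunE.
rewrite lfunE /= [RHS](bilinear_coord _ _ bilinear_map_tens).
by apply: eq_bigr => i _; apply: eq_bigr => j _; rewrite cP.
Qed.

(** ev extends the lift of bilinear maps to all maps B, linearly in B, so that
    differences of lifts can be treated as lifts of differences. *)
Record tensor_evaluation {W : finNormedModType R} (K : R)
    (ev : (V -> V -> W) -> VV -> W) : Prop := TensorEvaluation {
  ev_lift : forall B x, bilinear_map B -> tensor_lift tens B x = ev B x;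
  ev_tens : forall B v w, bilinear_map B -> ev B (tens v w) = B v w;
  ev_add : forall B x y, ev B (x + y) = ev B x + ev B y;
  ev_sub : forall B B' x, ev (fun v w => B v w - B' v w) x = ev B x - ev B' x;
  ev_bound : forall B b x, (forall v w, `|B v w| <= b * (`|v| * `|w|)) ->
    `|ev B x| <= K * b * `|x| }.

Lemma tensor_evaluation_ex (W : finNormedModType R) : exists K0 ev,
  forall K, K0 <= K -> @tensor_evaluation W K ev.
Proof.
have [c ctens xc] := tensor_coordinates.
have /choice[d dP] : forall ij : 'I_n * 'I_n, exists d : R, 0 <= d /\
    forall x, `|c ij.1 ij.2 x| <= d * `|x|.
  move=> [i j]; pose l : {linear VV -> R^o} := c i j.
  by have [d d0 hd] := linear_bounded l; exists d.
pose K0 := \sum_i \sum_j d (i, j) * (`|e i| * `|e j|).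
exists K0, (tensor_sum (fun i j => c i j)) => K K0K; split.
- move=> B x bB; rewrite /tensor_lift.
  have [l lB _] := bilinear_lift bB.
  case: xgetP => [l' _ l'B|/(_ l)]; last by move=> /(_ lB).
  rewrite {1}(xc x) /tensor_sum linear_sum; apply: eq_bigr => i _.
  by rewrite linear_sum; apply: eq_bigr => j _; rewrite linearZ /= l'B.
- move=> B v w bB; rewrite (bilinear_coord _ _ bB).
  by apply: eq_bigr => i _; apply: eq_bigr => j _; rewrite ctens.
- move=> B x y; rewrite /tensor_sum -big_split /=; apply: eq_bigr => i _.
  by rewrite -big_split /=; apply: eq_bigr => j _; rewrite linearD /= scalerDl.
- move=> B B' x; rewrite /tensor_sum -sumrB /=; apply: eq_bigr => i _.
  by rewrite -sumrB /=; apply: eq_bigr => j _; rewrite scalerBr.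
move=> B b x Bb.
apply: (@le_trans _ _ (K0 * b * `|x|)); last first.
  have [b0|b0] := leP 0 b; first by rewrite !ler_wpM2r.
  have [->|x0] := eqVneq x 0; first by rewrite normr0 !mulr0.
  have V0 (v : V) : v = 0.
    apply/eqP; rewrite -normr_eq0; apply: contraLR b0 => v0.
    have := le_trans (normr_ge0 _) (Bb v v).
    by rewrite -leNgt -expr2 pmulr_lge0// exprn_gt0// lt_def v0 normr_ge0.
  case/eqP: x0; rewrite (xc x) /tensor_sum big1// => i _; rewrite big1// => j _.
  by rewrite (V0 (e i)) linear0l scaler0.
rewrite /K0 !mulr_suml; apply: le_trans (ler_norm_sum _ _ _) _.
apply: ler_sum => i _; rewrite !mulr_suml; apply: le_trans (ler_norm_sum _ _ _) _.
apply: ler_sum => j _; rewrite normrZ.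
have -> : d (i, j) * (`|e i| * `|e j|) * b * `|x| =
   (d (i, j) * `|x|) * (b * (`|e i| * `|e j|)) by ring.
by rewrite ler_pM// (dP (i, j)).2.
Qed.

End TensorEvaluation.

(** * Sewing along dyadic partitions *)

Lemma exp2_gt_ex {R : realType} (x : R) : exists n, x < 2 ^+ n.
Proof.
exists (Num.truncn x).+1; apply: lt_le_trans (truncnS_gt _) _.
by rewrite -natrX ler_nat ltnW// ltn_expl.
Qed.

Section Sewing.
Context {R : realType} {E : finNormedModType R}.
Implicit Types (A : R -> R -> E) (a b : R) (s : seq R).

Fixpoint partition_sum A a s : E :=
  if s is x :: s' then A a x + partition_sum A x s' else 0.

Definition mesh_below (delta : R) := path (fun x y : R => y - x < delta).

Lemma partition_sum_nth A a b s :
  \sum_(0 <= n < size s) A (nth b (a :: s) n) (nth b (a :: s) n.+1) =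
  partition_sum A a s.
Proof.
elim: s a => [|x s ih] a /=; first by rewrite big_nil.
by rewrite big_nat_recl//= ih.
Qed.

Lemma partition_sum_cat A a s t :
  partition_sum A a (s ++ t) = partition_sum A a s + partition_sum A (last a s) t.
Proof. by elim: s a => [|x s ih] a /=; rewrite ?add0r// ih addrA. Qed.

Lemma partition_sum_sub A B a s :
  partition_sum (fun u v => A u v - B u v) a s =
  partition_sum A a s - partition_sum B a s.
Proof.
elim: s a => [|x s ih] a /=; first by rewrite subrr.
by rewrite ih opprD addrACA.
Qed.

Lemma partition_limitP a b A J : is_partition_limit a b A J <->
  forall eps : R, 0 < eps -> exists2 delta : R, 0 < delta &
    forall s, itv_partition a b s -> mesh_below delta a s ->
      `|partition_sum A a s - J| < eps.
Proof.
split=> AJ eps eps0; have [delta delta0 dP] := AJ eps eps0; exists delta => // s abs.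
  move=> /(pathP b) sd; have := dP s abs; rewrite /= partition_sum_nth; apply.
  exact: sd.
by move=> /= sd; rewrite partition_sum_nth; apply: dP => //; apply/(pathP b).
Qed.

Lemma partition_limitB a b A B J K : is_partition_limit a b A J ->
  is_partition_limit a b B K ->
  is_partition_limit a b (fun u v => A u v - B u v) (J - K).
Proof.
move=> /partition_limitP AJ /partition_limitP BK; apply/partition_limitP => eps eps0.
have eps2 : 0 < eps / 2 by rewrite divr_gt0.
have [d1 d10 d1P] := AJ _ eps2; have [d2 d20 d2P] := BK _ eps2.
exists (Num.min d1 d2) => [|s abs sd]; first by rewrite lt_min d10.
have mesh d : Num.min d1 d2 <= d -> mesh_below d a s.
  by move=> dd; apply: sub_path sd => x y /lt_le_trans; apply.
have h1 : `|partition_sum A a s - J| < eps / 2.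
  by apply: d1P => //; apply: mesh; rewrite ge_min lexx.
have h2 : `|partition_sum B a s - K| < eps / 2.
  by apply: d2P => //; apply: mesh; rewrite ge_min lexx orbT.
rewrite partition_sum_sub.
rewrite (_ : _ + _ = (partition_sum A a s - J) - (partition_sum B a s - K)); last by vring.
by apply: le_lt_trans (ler_normB _ _) _; rewrite [ltRHS]splitr ltrD.
Qed.

(** The left endpoint is omitted, as in itv_partition. *)
Fixpoint dyadic (n : nat) a b : seq R :=
  if n is m.+1 then dyadic m a ((a + b) / 2) ++ dyadic m ((a + b) / 2) b
  else [:: b].

Lemma last_dyadic n a b : last a (dyadic n a b) = b.
Proof. by elim: n a b => [|n ih] a b //=; rewrite last_cat !ih. Qed.

Lemma dyadic_partition n a b : a < b -> itv_partition a b (dyadic n a b).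
Proof.
elim: n a b => [|n ih] a b ab; first exact: itv_partition1.
by apply: itv_partition_cat; apply: ih; lra.
Qed.

Lemma dyadic_mesh delta n a b : b - a < delta * 2 ^+ n ->
  mesh_below delta a (dyadic n a b).
Proof.
elim: n a b => [|n ih] a b; first by rewrite expr0 mulr1 /mesh_below /= andbT.
rewrite exprS => abd; rewrite /mesh_below /= cat_path last_dyadic.
apply/andP; split; apply: ih; lra.
Qed.

Lemma fine_partition_ex delta a b : 0 < delta -> a <= b ->
  exists s, itv_partition a b s /\ mesh_below delta a s.
Proof.
move=> delta0; rewrite le_eqVlt => /predU1P[->|ab]; first by exists [::].
have [n nP] := exp2_gt_ex ((b - a) / delta).
exists (dyadic n a b); split; first exact: dyadic_partition.
by apply: dyadic_mesh; rewrite mulrC -ltr_pdivrMr.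
Qed.

Variables (w : R -> R) (theta : R).
Hypothesis w_half : forall x : R, 0 <= x -> w (x / 2) = theta * w x.
Hypothesis w_ge0 : forall x, 0 <= w x.
Hypothesis theta_lt : 2 * theta ^+ 3 < 1.

(** Halving an interval multiplies the cube of the gauge by theta^3 and doubles
    the number of intervals, so the defects sum to a geometric series. *)
Definition sewing_constant := (1 - 2 * theta ^+ 3)^-1.

Lemma sewing_constant_ge0 : 0 <= sewing_constant.
Proof. by rewrite invr_ge0 subr_ge0 ltW. Qed.

Definition defect A u m v : E := A u v - A u m - A m v.

Lemma dyadic_sum_close A (kappa : R) a b n : 0 <= kappa -> a < b ->
  (forall u v, a <= u -> u < v -> v <= b ->
    `|defect A u ((u + v) / 2) v| <= kappa * w (v - u) ^+ 3) ->
  `|partition_sum A a (dyadic n a b) - A a b| <=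
  sewing_constant * kappa * w (b - a) ^+ 3.
Proof.
move=> kappa0; elim: n a b => [|n ih] a b ab dA /=.
  rewrite addr0 subrr normr0 !mulr_ge0 ?exprn_ge0//; exact: sewing_constant_ge0.
set m := (a + b) / 2.
have am : a < m by rewrite /m; lra.
have mb : m < b by rewrite /m; lra.
have h1 : `|partition_sum A a (dyadic n a m) - A a m| <=
    sewing_constant * kappa * w (m - a) ^+ 3.
  by apply: ih => // u v au uv vm; apply: dA => //; exact: le_trans (ltW mb).
have h2 : `|partition_sum A m (dyadic n m b) - A m b| <=
    sewing_constant * kappa * w (b - m) ^+ 3.
  by apply: ih => // u v au uv vm; apply: dA => //; exact: le_trans (ltW am) _.
have h3 := dA a b (lexx _) ab (lexx _); rewrite -/m in h3.
rewrite partition_sum_cat last_dyadic.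
rewrite (_ : _ - _ = (partition_sum A a (dyadic n a m) - A a m) +
  (partition_sum A m (dyadic n m b) - A m b) - defect A a m b); last first.
  by rewrite /defect; vring.
apply: le_trans (ler_normB _ _) _.
apply: le_trans (lerD (ler_normD _ _) h3) _.
apply: le_trans (lerD (lerD h1 h2) (lexx _)) _.
have -> : m - a = (b - a) / 2 by rewrite /m; lra.
have -> : b - m = (b - a) / 2 by rewrite /m; lra.
have ba : 0 <= b - a by rewrite subr_ge0 ltW.
rewrite (w_half ba) exprMn.
(* the constant is the fixed point of the recursion over n *)
have C1 : sewing_constant = 1 + 2 * theta ^+ 3 * sewing_constant.
  have : 1 - 2 * theta ^+ 3 != 0 by rewrite gt_eqF// subr_gt0.
  by rewrite /sewing_constant => h; field.
rewrite [in leRHS]C1.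
by rewrite le_eqVlt; apply/orP; left; apply/eqP; ring.
Qed.

(** The germ approximates the increments of its integral: dyadic refinement of
    [s, t] does not move the sums by more than the defects allow. *)
Lemma sewing A (kappa : R) (J : R -> E) (s t : R) : 0 <= kappa -> 0 <= s -> s < t ->
  is_partition_limit 0 s A (J s) -> is_partition_limit 0 t A (J t) ->
  (forall u v, s <= u -> u < v -> v <= t ->
    `|defect A u ((u + v) / 2) v| <= kappa * w (v - u) ^+ 3) ->
  `|J t - J s - A s t| <= sewing_constant * kappa * w (t - s) ^+ 3.
Proof.
move=> kappa0 s0 st /partition_limitP As /partition_limitP At dA.
apply/ler_addgt0Pr => eps eps0.
have eps2 : 0 < eps / 2 by rewrite divr_gt0.
have [d1 d10 d1P] := As _ eps2; have [d2 d20 d2P] := At _ eps2.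
pose d := Num.min d1 d2.
have d0 : 0 < d by rewrite lt_min d10.
have mesh d' a' s' : d <= d' -> mesh_below d a' s' -> mesh_below d' a' s'.
  by move=> dd; apply: sub_path => x y /lt_le_trans; apply.
have [s1 [p1 m1]] := fine_partition_ex d0 s0.
have [n nP] := exp2_gt_ex ((t - s) / d).
have m2 : mesh_below d s (dyadic n s t).
  by apply: dyadic_mesh; rewrite mulrC -ltr_pdivrMr.
have h1 : `|partition_sum A 0 s1 - J s| < eps / 2.
  by apply: d1P => //; apply: mesh m1; rewrite ge_min lexx.
have h2 := d2P _ (itv_partition_cat p1 (dyadic_partition n st)).
have ls1 : last 0 s1 = s by case: p1 => _ /eqP.
have {}h2 : `|partition_sum A 0 s1 + partition_sum A s (dyadic n s t) - J t| < eps / 2.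
  rewrite -{1}ls1 -partition_sum_cat; apply: h2.
  apply: (mesh d2); first by rewrite ge_min lexx orbT.
  by rewrite /mesh_below cat_path ls1; apply/andP.
have h3 := dyadic_sum_close n kappa0 st dA.
rewrite (_ : J t - _ - _ = (partition_sum A s (dyadic n s t) - A s t) +
  ((partition_sum A 0 s1 - J s) -
   (partition_sum A 0 s1 + partition_sum A s (dyadic n s t) - J t))); last by vring.
apply: le_trans (ler_normD _ _) _; rewrite lerD//.
by apply: le_trans (ler_normB _ _) _; rewrite [leRHS]splitr lerD// ltW.
Qed.

End Sewing.

(** * The drift integral *)

Section DriftIntegral.
Context {R : realType} {W : finNormedModType R}.

Lemma powR_continuous_at0 (alpha c eps : R) : 0 < alpha -> 0 <= c -> 0 < eps ->
  exists2 delta : R, 0 < delta & forall x, 0 <= x <= delta -> c * x `^ alpha <= eps.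
Proof.
move=> alpha0 c0 eps0; have e0 : 0 < eps / (c + 1) by rewrite divr_gt0// ltr_wpDl.
exists ((eps / (c + 1)) `^ alpha^-1) => [|x /andP[x0 xd]]; first exact: powR_gt0.
have : x `^ alpha <= eps / (c + 1).
  have -> : eps / (c + 1) = ((eps / (c + 1)) `^ alpha^-1) `^ alpha.
    by rewrite -powRrM mulVf ?gt_eqF// powRr1// ltW.
  by rewrite ge0_ler_powR ?nnegrE ?powR_ge0// ltW.
rewrite ler_pdivlMr ?ltr_wpDl// => xe; apply: le_trans xe.
by rewrite mulrC mulrDr mulr1 lerDl powR_ge0.
Qed.

Lemma hoelder_continuous (f : R -> W) (alpha c a b : R) : 0 < alpha -> 0 <= c ->
  (forall u v, a <= u -> u <= v -> v <= b ->
    `|f v - f u| <= c * (v - u) `^ alpha) ->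
  {within `[a, b], continuous f}.
Proof.
move=> alpha0 c0 fH; apply/subspace_continuousP => x /=; rewrite in_itv /= => /andP[ax xb].
apply/cvgrPdist_le => eps eps0.
have [delta delta0 dP] := powR_continuous_at0 alpha0 c0 eps0.
rewrite near_withinE; near=> y => /=; rewrite in_itv /= => /andP[ay yb].
have xy : `|x - y| <= delta by near: y; apply: cvgr_dist_le.
have [le|/ltW le] := leP x y.
  rewrite distrC; apply: le_trans (fH _ _ ax le yb) _; apply: dP.
  by rewrite subr_ge0 le/=; apply: le_trans xy; rewrite distrC ler_norm.
apply: le_trans (fH _ _ ay le xb) _; apply: dP.
by rewrite subr_ge0 le/=; apply: le_trans xy; rewrite ler_norm.
Unshelve. all: by end_near. Qed.

Lemma coord_integrable (f : R -> W) (a b : R) i :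
  {within `[a, b], continuous f} ->
  lebesgue_measure.-integrable `[a, b] (EFin \o (fun r => coord (vbasis {:W}) i (f r))).
Proof.
move=> fc; apply: continuous_compact_integrable; first exact: segment_compact.
have [C C0 hC] := coord_bounded W.
pose l : {linear W -> R^o} := coord (vbasis {:W}) i.
have lcont : continuous l.
  apply: bounded_linear_continuous; apply/linear_boundedP.
  by near=> r => x; apply: le_trans (hC x i) _; rewrite ler_wpM2r.
apply/subspace_continuousP => x abx.
move/subspace_continuousP : fc => /(_ x abx) fx.
exact: (cvg_comp _ _ fx (lcont (f x))).
Unshelve. all: by end_near. Qed.

Lemma vintegralB (f g : R -> W) (t : R) :
  {within `[0, t], continuous f} -> {within `[0, t], continuous g} ->
  vintegral `[0, t] (fun r => f r - g r) = vintegral `[0, t] f - vintegral `[0, t] g.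
Proof.
move=> fc gc; rewrite /vintegral -sumrB; apply: eq_bigr => i _.
rewrite -scalerBl; congr (_ *: _).
rewrite -RintegralB//; try exact: coord_integrable.
by apply: eq_Rintegral => r _; rewrite coord_add coord_opp.
Qed.

Lemma vintegral_increment_ex : exists2 K : R, 0 <= K &
  forall (f : R -> W) (s t M : R), 0 <= s -> s <= t ->
    {within `[0, t], continuous f} ->
    (forall r, s <= r <= t -> `|f r| <= M) ->
    `|vintegral `[0, t] f - vintegral `[0, s] f| <= K * M * (t - s).
Proof.
have [C C0 hC] := coord_bounded W; have [D D0 hD] := norm_le_coord W.
exists (D * C) => [|f s t M s0 st fc fM]; first exact: mulr_ge0.
rewrite -!mulrA; apply: hD => i.
have coord_vint (b : R) :
    coord (vbasis {:W}) i (vintegral `[0, b] f) =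
    (\int[lebesgue_measure]_(r in `[0, b]) coord (vbasis {:W}) i (f r))%R.
  rewrite /vintegral coord_sum_free//.
  by have /andP[_] := vbasisP {:W}.
rewrite coord_add coord_opp !coord_vint.
have fi := coord_integrable i fc.
rewrite Rintegral_itvB ?bnd_simp//.
have fi' : lebesgue_measure.-integrable `]s, t] (EFin \o (fun r => coord (vbasis {:W}) i (f r))).
  by apply: integrableS fi => //; apply: subset_itvr; rewrite bnd_simp.
have ci : lebesgue_measure.-integrable `]s, t] (EFin \o cst (C * M)).
  have : lebesgue_measure.-integrable `[s, t] (EFin \o cst (C * M)).
    apply: continuous_compact_integrable; first exact: segment_compact.
    by apply: continuous_subspaceT => x; exact: cst_continuous.
  by apply: integrableS => //; exact: subset_itv_oc_cc.
apply: le_trans (le_normr_Rintegral _ fi') _ => //.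
apply: (@le_trans _ _ (\int[lebesgue_measure]_(r in `]s, t]) cst (C * M) r)%R).
  apply: le_Rintegral => //.
    exact: (integrable_norm fi').
  move=> r /=; rewrite in_itv /= => /andP[sr rt].
  by apply: le_trans (hC _ _) _; rewrite ler_wpM2l// fM// (ltW sr).
rewrite Rintegral_cst//= lebesgue_measure_itv /= lte_fin.
have [_|ts] := ltP s t; first by rewrite -EFinD /= mulrA.
by rewrite /= mulr0 (@le_anti _ _ s t) ?st//= subrr !mulr0.
Qed.

End DriftIntegral.

(** * Local estimates for the rough differential equation *)

Section HalvingIteration.
Context {R : realType}.

(** An estimate that improves from x to c + x / 2 holds with a constant
    arbitrarily close to 2 c as soon as it holds with some finite constant. *)
Lemma halving_iteration (P : R -> Prop) (c x0 eps : R) :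
  (forall x, 0 <= x -> P x -> P (c + x / 2)) -> 0 <= c -> 0 <= x0 -> P x0 ->
  0 < eps -> exists2 x, 0 <= x <= 2 * c + eps & P x.
Proof.
move=> step c0 x00 Px0 eps0.
have it n : exists2 x, 0 <= x <= 2 * c + x0 / 2 ^+ n & P x.
  elim: n => [|n [x /andP[xge0 xle] Px]].
    by exists x0 => //; rewrite x00 expr0 divr1 lerDr mulr_ge0.
  exists (c + x / 2); last exact: step.
  rewrite addr_ge0 ?divr_ge0//= exprS invfM mulrCA.
  by move: xle; set q := x0 / _ => xle; lra.
have [n /ltW nP] := exp2_gt_ex (x0 / eps).
have [x /andP[xge0 xle] Px] := it n; exists x => //; rewrite xge0/=.
apply: le_trans xle _; rewrite lerD2l ler_pdivrMr ?exprn_gt0//.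
by rewrite mulrC -ler_pdivrMr.
Qed.

End HalvingIteration.

Section HoelderGauge.
Context {R : realType} (alpha : R).
Hypothesis alpha_gt : 3^-1 < alpha.
Hypothesis alpha_le : alpha <= 2^-1.

Definition gauge (x : R) : R := x `^ alpha.

Let alpha_gt0 : 0 < alpha. Proof. by apply: lt_trans alpha_gt. Qed.

Lemma gauge_ge0 x : 0 <= gauge x. Proof. exact: powR_ge0. Qed.

Lemma gauge_le x y : 0 <= x -> x <= y -> gauge x <= gauge y.
Proof.
move=> x0 xy; rewrite /gauge ge0_ler_powR ?nnegrE ?(ltW alpha_gt0)//.
exact: le_trans xy.
Qed.

Lemma gauge_half x : 0 <= x -> gauge (x / 2) = gauge 2^-1 * gauge x.
Proof. by move=> x0; rewrite /gauge powRM ?invr_ge0// mulrC. Qed.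

(** The exponent 3 alpha exceeds 1, which makes sewing possible. *)
Lemma gauge_half_lt : 2 * gauge 2^-1 ^+ 3 < 1.
Proof.
rewrite /gauge -powR_mulrn ?powR_ge0// -powRrM.
rewrite -[X in _ < X](@divff _ 2)// ltr_pM2l//.
have h0 : (0 : R) < 2^-1 by rewrite invr_gt0.
rewrite -[X in _ < X]powRr1 ?(ltW h0)//.
rewrite /powR gt_eqF// ltr_expR ltr_nM2r; first by move: alpha_gt; lra.
by rewrite ln_lt0// h0 invf_lt1// ltr1n.
Qed.

Lemma gauge_le1 x : 0 <= x <= 1 -> gauge x <= 1.
Proof.
by move=> /andP[x0 x1]; apply: le_trans (gauge_le x0 x1) _; rewrite /gauge powR1.
Qed.

(** The drift, of order |t - s|, is at least as small as the remainders, of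
    order 2 alpha. *)
Lemma le_gauge_sqr x : 0 <= x <= 1 -> x <= gauge x ^+ 2.
Proof.
move=> /andP[]; rewrite le_eqVlt => /predU1P[<- _|x0 x1]; first exact: sqr_ge0.
rewrite /gauge -powR_mulrn ?powR_ge0// -powRrM.
by apply: ger1_powR; rewrite ?x0//; move: alpha_le; lra.
Qed.

End HoelderGauge.

Section RoughStep.
Context {R : realType} {U V VV W : finNormedModType R}.
Variables (tens : {bilinear V -> V -> VV}) (alpha : R).
Hypothesis alpha_gt : 3^-1 < alpha.
Hypothesis alpha_le : alpha <= 2^-1.
Let w := gauge alpha.

Record driver_bounds (L T : R) (X : R -> V) (XX : R -> R -> VV)
    (Z : R -> U) (Z' : R -> 'Hom(V, U)) : Prop := DriverBounds {
  path_increment_le : forall s t : R, 0 <= s -> s <= t -> t <= T ->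
    `|increment X s t| <= L * w (t - s);
  area_le : forall s t : R, 0 <= s -> s <= t -> t <= T ->
    `|XX s t| <= L * w (t - s) ^+ 2;
  driver_derivative_le : forall t : R, 0 <= t -> t <= T -> `|Z' t| <= L;
  driver_derivative_increment_le : forall s t : R, 0 <= s -> s <= t -> t <= T ->
    `|Z' t - Z' s| <= L * w (t - s);
  driver_remainder_le : forall s t : R, 0 <= s -> s <= t -> t <= T ->
    `|remainder X Z Z' s t| <= L * w (t - s) ^+ 2;
  driver_chen : forall s u t : R, 0 <= s -> s <= u -> u <= t -> t <= T ->
    XX s t = XX s u + XX u t + tens (increment X s u) (increment X u t) }.

Variables (L T : R) (F : W -> 'Hom(U, W)) (DF : W -> 'Hom(W, 'Hom(U, W)))
  (F0 : W -> W) (X : R -> V) (XX : R -> R -> VV) (Z : R -> U)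
  (Z' : R -> 'Hom(V, U)) (ev : (V -> V -> W) -> VV -> W).
Hypothesis L_ge1 : 1 <= L.
Hypothesis FB : field_bounds L F DF F0.
Hypothesis DB : driver_bounds L T X XX Z Z'.
Hypothesis evP : tensor_evaluation tens L ev.
Hypothesis sewing_le : sewing_constant (gauge alpha 2^-1) <= L.
Hypothesis drift_le : forall (f : R -> W) (s t M : R), 0 <= s -> s <= t ->
    {within `[0, t], continuous f} ->
    (forall r, s <= r <= t -> `|f r| <= M) ->
    `|vintegral `[0, t] f - vintegral `[0, s] f| <= L * M * (t - s).

Definition area_form (Y : R -> W) (u : R) (v1 v2 : V) : W :=
  second_field F DF (Y u) (Z' u v1) (Z' u v2).

Definition germ (Y : R -> W) (u v : R) : W :=
  F (Y u) (increment Z u v) + ev (area_form Y u) (XX u v).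

(** The remainder of Y with Gubinelli derivative F(Y) Z'. *)
Definition solution_remainder (Y : R -> W) (s t : R) : W :=
  increment Y s t - F (Y s) (Z' s (increment X s t)).

Record solution_path (y : W) (Y : R -> W) : Prop := SolutionPath {
  path_equation : exists J : R -> W, forall t : R, 0 <= t -> t <= T ->
    is_partition_limit 0 t (germ Y) (J t) /\
    Y t = y + J t + vintegral `[0, t] (F0 \o Y);
  path_continuous : forall t : R, 0 <= t -> t <= T -> {within `[0, t], continuous (F0 \o Y)};
  path_remainder : exists2 rho : R, 0 <= rho &
    forall s t : R, 0 <= s -> s <= t -> t <= T ->
      `|solution_remainder Y s t| <= rho * w (t - s) ^+ 2 }.

Let L_ge0 : 0 <= L. Proof. exact: le_trans L_ge1. Qed.

Let w_ge0 x : 0 <= w x. Proof. exact: gauge_ge0. Qed.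

Lemma area_form_bilinear (Y : R -> W) (u : R) : bilinear_map (area_form Y u).
Proof.
by split=> [v2|v1] a x y; rewrite /area_form /second_field !linearP
  ?(add_lfunE, scale_lfunE).
Qed.

(** The part of the increment of Z that is not seen at order |v - u|^alpha
    from time u. *)
Definition driver_error (u m v : R) : U :=
  (Z' m - Z' u) (increment X m v) + remainder X Z Z' m v.

Definition first_order_error (Y : R -> W) (u m : R) : 'Hom(U, W) :=
  F (Y m) - F (Y u) - DF (Y u) (F (Y u) (Z' u (increment X u m))).

Definition area_form_increment (Y : R -> W) (u m : R) (v1 v2 : V) : W :=
  area_form Y m v1 v2 - area_form Y u v1 v2.

(** By Chen's relation the terms of order 2 alpha cancel, up to replacing
    Y_{u,m} by Y'_u X_{u,m} and Z_{m,v} by Z'_u X_{m,v}. *)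
Lemma defect_germ (Y : R -> W) (u m v : R) : 0 <= u -> u <= m -> m <= v -> v <= T ->
  defect (germ Y) u m v =
  - (first_order_error Y u m (Z' u (increment X m v)) +
     (F (Y m) - F (Y u)) (driver_error u m v) +
     ev (area_form_increment Y u m) (XX m v)).
Proof.
move=> u0 um mv vT; rewrite /defect /germ.
rewrite (driver_chen DB u0 um mv vT) !(ev_add evP) (ev_tens evP _ _ (area_form_bilinear Y u)).
rewrite [ev (area_form_increment _ _ _) _](ev_sub evP).
have -> : increment Z u v = increment Z u m + increment Z m v.
  by rewrite /increment; vring.
have -> : increment Z m v = Z' u (increment X m v) + driver_error u m v.
  rewrite /driver_error /remainder !(add_lfunE, opp_lfunE); vring.
rewrite /first_order_error /area_form /second_field.
move: (driver_error _ _ _) (increment Z u m) => er z.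
move: (Z' u (increment X m v)) (Z' u (increment X u m)) => x xi.
by rewrite !(add_lfunE, opp_lfunE) !linearD; vring.
Qed.

(** Stated for arbitrary G, D and B because it serves both one solution and the
    difference of two, the defect being linear in these three. *)
Lemma defect_terms_le (G D : 'Hom(U, W)) (B : V -> V -> W) (g f b u m v : R) :
  0 <= u -> u <= m -> m <= v -> v <= T ->
  0 <= g -> 0 <= f -> 0 <= b ->
  `|G| <= g * w (v - u) ^+ 2 -> `|D| <= f * w (v - u) ->
  (forall v1 v2, `|B v1 v2| <= b * w (v - u) * (`|v1| * `|v2|)) ->
  `|G (Z' u (increment X m v)) + D (driver_error u m v) + ev B (XX m v)| <=
  (g + 2 * f + b) * L ^+ 2 * w (v - u) ^+ 3.
Proof.
move=> u0 um mv vT g0 f0 b0 Gg Df Bb.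
have m0 : 0 <= m by exact: le_trans um.
have mT : m <= T by exact: le_trans vT.
have uT : u <= T by exact: le_trans mT.
have wmv : w (v - m) <= w (v - u) by apply: gauge_le; rewrite ?subr_ge0 ?lerB// lerD2l lerN2.
have wum : w (m - u) <= w (v - u) by apply: gauge_le; rewrite ?subr_ge0// lerD2r.
set om := w (v - u) in Gg Df Bb wmv wum *.
have om0 : 0 <= om by exact: w_ge0.
have Xmv : `|increment X m v| <= L * om.
  by apply: le_trans (path_increment_le DB m0 mv vT) _; rewrite ler_wpM2l.
have Rmv : `|remainder X Z Z' m v| <= L * om ^+ 2.
  apply: le_trans (driver_remainder_le DB m0 mv vT) _.
  by rewrite ler_wpM2l// lerXn2r ?nnegrE ?w_ge0.
have Amv : `|XX m v| <= L * om ^+ 2.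
  apply: le_trans (area_le DB m0 mv vT) _.
  by rewrite ler_wpM2l// lerXn2r ?nnegrE ?w_ge0.
have Zum : `|Z' m - Z' u| <= L * om.
  by apply: le_trans (driver_derivative_increment_le DB u0 um mT) _; rewrite ler_wpM2l.
have h1 : `|G (Z' u (increment X m v))| <= (g * om ^+ 2) * (L * (L * om)).
  apply: le_trans (lfun_norm_le _ _) _; rewrite ler_pM//.
  apply: le_trans (lfun_norm_le _ _) _; rewrite ler_pM//.
  exact: driver_derivative_le DB _ u0 uT.
have h2 : `|D (driver_error u m v)| <= (f * om) * ((L * om) * (L * om) + L * om ^+ 2).
  apply: le_trans (lfun_norm_le _ _) _; rewrite ler_pM//.
  apply: le_trans (ler_normD _ _) _; rewrite lerD//.
  by apply: le_trans (lfun_norm_le _ _) _; rewrite ler_pM.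
have h3 : `|ev B (XX m v)| <= L * (b * om) * (L * om ^+ 2).
  apply: le_trans (ev_bound evP _ Bb) _.
  by rewrite ler_wpM2l// !mulr_ge0.
apply: le_trans (ler_normD _ _) _.
apply: le_trans (lerD (ler_normD _ _) (lexx _)) _.
apply: le_trans (lerD (lerD h1 h2) h3) _.
have -> : (g + 2 * f + b) * L ^+ 2 * om ^+ 3 =
  g * om ^+ 2 * (L * (L * om)) + f * om * (L * om * (L * om) + L * om ^+ 2) +
  L * (b * om) * (L * om ^+ 2) + f * om ^+ 3 * (L * (L - 1)) by ring.
by rewrite lerDl !mulr_ge0 ?exprn_ge0 ?subr_ge0.
Qed.

Lemma area_form_le (Y : R -> W) (u : R) v1 v2 : 0 <= u -> u <= T ->
  `|area_form Y u v1 v2| <= L ^+ 4 * (`|v1| * `|v2|).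
Proof.
move=> u0 uT; apply: le_trans (second_field_norm FB _ _ _) _.
have zl (v : V) : `|Z' u v| <= L * `|v|.
  apply: le_trans (lfun_norm_le _ _) _; rewrite ler_wpM2r//.
  exact: driver_derivative_le DB _ u0 uT.
have -> : L ^+ 4 * (`|v1| * `|v2|) = (L ^+ 2 * (L * `|v1|)) * (L * `|v2|) by ring.
by rewrite ler_pM ?mulr_ge0 ?sqr_ge0// ler_wpM2l ?sqr_ge0.
Qed.

Lemma derivative_term_le (Y : R -> W) (u m : R) : 0 <= u -> u <= m -> m <= T ->
  `|F (Y u) (Z' u (increment X u m))| <= L ^+ 3 * w (m - u).
Proof.
move=> u0 um mT; apply: le_trans (field_le FB _ _) _.
have -> : L ^+ 3 * w (m - u) = L * (L * (L * w (m - u))) by ring.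
rewrite ler_wpM2l//; apply: le_trans (lfun_norm_le _ _) _; rewrite ler_pM//.
  by apply: driver_derivative_le DB _ u0 _; exact: le_trans mT.
exact (path_increment_le DB u0 um mT).
Qed.

Lemma solution_increment_le (Y : R -> W) (rho u m : R) : 0 <= u -> u <= m -> m <= T ->
  m - u <= 1 -> 0 <= rho ->
  `|solution_remainder Y u m| <= rho * w (m - u) ^+ 2 ->
  `|Y m - Y u| <= (L ^+ 3 + rho) * w (m - u).
Proof.
move=> u0 um mT mu1 rho0 Rum.
have -> : Y m - Y u = F (Y u) (Z' u (increment X u m)) + solution_remainder Y u m.
  by rewrite /solution_remainder /increment; vring.
apply: le_trans (ler_normD _ _) _; rewrite mulrDl lerD ?derivative_term_le//.
apply: le_trans Rum _; rewrite ler_wpM2l// expr2 ler_piMr//.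
by apply: gauge_le1 => //; rewrite subr_ge0 um.
Qed.

Lemma solution_remainder_eq (Y J : R -> W) (y : W) (s t : R) :
  Y s = y + J s + vintegral `[0, s] (F0 \o Y) ->
  Y t = y + J t + vintegral `[0, t] (F0 \o Y) ->
  solution_remainder Y s t = F (Y s) (remainder X Z Z' s t) +
    ev (area_form Y s) (XX s t) + (J t - J s - germ Y s t) +
    (vintegral `[0, t] (F0 \o Y) - vintegral `[0, s] (F0 \o Y)).
Proof.
move=> Ys Yt; rewrite /solution_remainder [in LHS]/increment /germ /remainder.
have -> : Y t - Y s = (J t - J s) +
    (vintegral `[0, t] (F0 \o Y) - vintegral `[0, s] (F0 \o Y)).
  by rewrite {1}Yt {1}Ys; vring.
rewrite linearB; vring.
Qed.

Lemma area_form_increment_le (Y : R -> W) (r u m v : R) v1 v2 :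
  0 <= u -> u <= m -> m <= v -> v <= T -> 0 <= r ->
  `|Y m - Y u| <= r * w (v - u) ->
  `|area_form_increment Y u m v1 v2| <=
    (2 * L ^+ 4 * (r + 1)) * w (v - u) * (`|v1| * `|v2|).
Proof.
move=> u0 um mv vT r0 Yum.
have mT : m <= T by exact: le_trans vT.
have m0 : 0 <= m by exact: le_trans um.
have uT : u <= T by exact: le_trans mT.
have wum : w (m - u) <= w (v - u) by apply: gauge_le; rewrite ?subr_ge0// lerD2r.
have zl s (v' : V) : 0 <= s -> s <= T -> `|Z' s v'| <= L * `|v'|.
  move=> s0 sT; apply: le_trans (lfun_norm_le _ _) _; rewrite ler_wpM2r//.
  exact: driver_derivative_le DB _ s0 sT.
have zd (v' : V) : `|(Z' m - Z' u) v'| <= L * w (v - u) * `|v'|.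
  apply: le_trans (lfun_norm_le _ _) _; rewrite ler_wpM2r//.
  apply: le_trans (driver_derivative_increment_le DB u0 um mT) _.
  by rewrite ler_wpM2l.
have -> : area_form_increment Y u m v1 v2 =
   (second_field F DF (Y m) (Z' m v1) (Z' m v2) -
    second_field F DF (Y u) (Z' m v1) (Z' m v2)) +
   (second_field F DF (Y u) ((Z' m - Z' u) v1) (Z' m v2) +
    second_field F DF (Y u) (Z' u v1) ((Z' m - Z' u) v2)).
  rewrite /area_form_increment /area_form /second_field !(add_lfunE, opp_lfunE).
  by rewrite !linearB !(add_lfunE, opp_lfunE); vring.
have h1 := second_field_lip FB (Y u) (Y m) (Z' m v1) (Z' m v2).
have h2 := second_field_norm FB (Y u) ((Z' m - Z' u) v1) (Z' m v2).
have h3 := second_field_norm FB (Y u) (Z' u v1) ((Z' m - Z' u) v2).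
apply: le_trans (ler_normD _ _) _.
apply: le_trans (lerD (lexx _) (ler_normD _ _)) _.
apply: le_trans (lerD h1 (lerD h2 h3)) _.
have -> : 2 * L ^+ 4 * (r + 1) * w (v - u) * (`|v1| * `|v2|) =
  2 * L ^+ 2 * (r * w (v - u)) * ((L * `|v1|) * (L * `|v2|)) +
  (L ^+ 2 * (L * w (v - u) * `|v1|) * (L * `|v2|) +
   L ^+ 2 * (L * `|v1|) * (L * w (v - u) * `|v2|)) by ring.
rewrite lerD//; last rewrite lerD//.
- rewrite ler_pM ?mulr_ge0 ?exprn_ge0//; first by rewrite ler_wpM2l ?mulr_ge0 ?exprn_ge0.
  by rewrite ler_pM// zl.
- by rewrite ler_pM ?mulr_ge0 ?exprn_ge0 ?zl// ler_wpM2l ?exprn_ge0 ?zd.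
- by rewrite ler_pM ?mulr_ge0 ?exprn_ge0 ?zd// ler_wpM2l ?exprn_ge0 ?zl.
Qed.

(** Passing through the intermediate point Y_u + Y'_u X_{u,m}, which differs
    from Y_m by the remainder, gives a bound that is linear in rho. A direct
    Taylor expansion from Y_u to Y_m would leave a term in rho^2, out of reach of
    the halving iteration. *)
Lemma first_order_error_le (Y : R -> W) (rho u m : R) :
  0 <= u -> u <= m -> m <= T ->
  `|solution_remainder Y u m| <= rho * w (m - u) ^+ 2 ->
  `|first_order_error Y u m| <= (L * rho + L ^+ 7) * w (m - u) ^+ 2.
Proof.
move=> u0 um mT Rum.
pose x := F (Y u) (Z' u (increment X u m)).
have -> : first_order_error Y u m = (F (Y m) - F (Y u + x)) +
    taylor_remainder F DF (Y u) x.
  by rewrite /first_order_error /taylor_remainder -/x; vring.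
apply: le_trans (ler_normD _ _) _; rewrite mulrDl lerD//.
  apply: le_trans (field_lip FB _ _) _; rewrite -mulrA ler_wpM2l//.
  apply: le_trans Rum; rewrite /solution_remainder /increment -/x.
  by rewrite opprD addrA.
apply: le_trans (remainder_quadratic (field_rd FB) _ _) _.
have -> : L ^+ 7 * w (m - u) ^+ 2 = L * (L ^+ 3 * w (m - u)) ^+ 2 by ring.
rewrite ler_wpM2l//.
by rewrite lerXn2r ?nnegrE ?mulr_ge0 ?exprn_ge0// derivative_term_le.
Qed.

Lemma apriori_arith (rho : R) : 0 <= rho ->
  L * ((L * rho + L ^+ 7 + 2 * (L * (L ^+ 3 + rho)) +
        2 * L ^+ 4 * (L ^+ 3 + rho + 1)) * L ^+ 2) <= 7 * L ^+ 10 * (1 + rho).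
Proof.
move=> rho0.
have p k : (k <= 10)%N -> L ^+ k <= L ^+ 10 by move=> k10; rewrite ler_weXn2l.
have p4 := ler_wpM2r rho0 (p 4%N isT).
have p7 := p 7%N isT; have p7r := ler_wpM2r rho0 p7.
have p10 : 0 <= L ^+ 10 by rewrite exprn_ge0.
nra.
Qed.

(** Sewing bounds the remainder by a term of order w^2 that does not involve
    rho, plus (1 + rho) w^3; on a short interval the extra factor w absorbs the
    coefficient of rho. *)
Lemma apriori_step (y : W) (Y : R -> W) (rho a b : R) : solution_path y Y ->
  0 <= a -> a <= b -> b <= T -> b - a <= 1 -> 14 * L ^+ 10 * w (b - a) <= 1 ->
  0 <= rho ->
  (forall s t, a <= s -> s <= t -> t <= b ->
    `|solution_remainder Y s t| <= rho * w (t - s) ^+ 2) ->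
  (forall s t, a <= s -> s <= t -> t <= b ->
    `|solution_remainder Y s t| <= (4 * L ^+ 6 + rho / 2) * w (t - s) ^+ 2).
Proof.
move=> [[J JP] Yc _] a0 ab bT ba1 small rho0 Rrho s t as_ st tb.
have s0 : 0 <= s by exact: le_trans as_.
have t0 : 0 <= t by exact: le_trans st.
have tT : t <= T by exact: le_trans bT.
have sT : s <= T by exact: le_trans tT.
have [sE|st'] := eqVneq s t.
  rewrite /solution_remainder /increment sE !(subrr, linear0, addr0) normr0.
  by rewrite mulr_ge0 ?sqr_ge0// addr_ge0 ?mulr_ge0 ?exprn_ge0 ?divr_ge0.
have {}st' : s < t by rewrite lt_neqAle st' st.
have [JLs Ys] := JP s s0 sT; have [JLt Yt] := JP t t0 tT.
rewrite (solution_remainder_eq Ys Yt).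
pose g := L * rho + L ^+ 7; pose f := L * (L ^+ 3 + rho).
pose c := 2 * L ^+ 4 * (L ^+ 3 + rho + 1).
have L3 : 0 <= L ^+ 3 by rewrite exprn_ge0.
have g0 : 0 <= g by rewrite addr_ge0 ?mulr_ge0 ?exprn_ge0.
have f0 : 0 <= f by rewrite mulr_ge0 ?addr_ge0 ?exprn_ge0.
have c0 : 0 <= c by rewrite !mulr_ge0 ?addr_ge0 ?exprn_ge0.
have dA u v : s <= u -> u < v -> v <= t ->
    `|defect (germ Y) u ((u + v) / 2) v| <= ((g + 2 * f + c) * L ^+ 2) * w (v - u) ^+ 3.
  move=> su uv vt; set m := (u + v) / 2.
  have u0 : 0 <= u by exact: le_trans su.
  have um : u <= m by rewrite /m; lra.
  have mv : m <= v by rewrite /m; lra.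
  have vT : v <= T by exact: le_trans tT.
  have mT : m <= T by exact: le_trans vT.
  have au : a <= u by exact: le_trans su.
  have mb : m <= b by apply: le_trans mv _; apply: le_trans tb.
  have wum : w (m - u) <= w (v - u) by apply: gauge_le; rewrite ?subr_ge0// lerD2r.
  have Rum := Rrho u m au um mb.
  have Yum : `|Y m - Y u| <= (L ^+ 3 + rho) * w (v - u).
    apply: le_trans (solution_increment_le _ _ _ _ _ Rum) _ => //.
      by apply: le_trans ba1; rewrite lerB.
    by rewrite ler_wpM2l// addr_ge0.
  rewrite defect_germ// normrN; apply: defect_terms_le => //.
  - apply: le_trans (first_order_error_le u0 um mT Rum) _.
    by rewrite ler_wpM2l// lerXn2r// nnegrE.
  - by apply: le_trans (field_lip FB _ _) _; rewrite -mulrA ler_wpM2l.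
  move=> v1 v2; apply: (area_form_increment_le v1 v2 u0 um mv vT _ Yum).
  by rewrite addr_ge0.
have k0 : 0 <= (g + 2 * f + c) * L ^+ 2.
  apply: mulr_ge0; last exact: exprn_ge0.
  by apply: addr_ge0 => //; apply: addr_ge0 => //; exact: mulr_ge0.
have sew := sewing (gauge_half alpha) (gauge_ge0 alpha)
  (gauge_half_lt alpha_gt) k0 s0 st' JLs JLt dA.
have {}sew : `|J t - J s - germ Y s t| <= (1 + rho) / 2 * w (t - s) ^+ 2.
  apply: le_trans sew _; rewrite -/w (exprS (w (t - s)) 2) mulrA ler_wpM2r ?sqr_ge0//.
  apply: (@le_trans _ _ (7 * L ^+ 10 * (1 + rho) * w (b - a))).
    rewrite ler_pM//; first by rewrite mulr_ge0 ?sewing_constant_ge0 ?gauge_half_lt.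
      by apply: le_trans (apriori_arith rho0); rewrite ler_wpM2r.
    by apply: gauge_le => //; rewrite ?subr_ge0// lerB.
  have : 14 * L ^+ 10 * w (b - a) * (1 + rho) <= 1 * (1 + rho).
    by rewrite ler_wpM2r// addr_ge0.
  by lra.
have ts1 : 0 <= t - s <= 1.
  by rewrite subr_ge0 st/=; apply: le_trans ba1; rewrite lerB.
have tsw := le_gauge_sqr alpha_le ts1; rewrite -/w in tsw.
have h1 : `|F (Y s) (remainder X Z Z' s t)| <= L * (L * w (t - s) ^+ 2).
  apply: le_trans (field_le FB _ _) _; rewrite ler_wpM2l//.
  exact (driver_remainder_le DB s0 st tT).
have h2 : `|ev (area_form Y s) (XX s t)| <= L * L ^+ 4 * (L * w (t - s) ^+ 2).
  apply: le_trans (ev_bound evP _ (fun v1 v2 => area_form_le Y v1 v2 s0 sT)) _.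
  by rewrite ler_wpM2l ?mulr_ge0 ?exprn_ge0//; exact (area_le DB s0 st tT).
have h3 : `|vintegral `[0, t] (F0 \o Y) - vintegral `[0, s] (F0 \o Y)| <=
    L * L * w (t - s) ^+ 2.
  apply: le_trans (drift_le s0 st (Yc t t0 tT) (fun r _ => drift_norm FB (Y r))) _.
  by rewrite ler_wpM2l// mulr_ge0.
apply: le_trans (ler_normD _ _) _.
apply: le_trans (lerD (ler_normD _ _) (lexx _)) _.
apply: le_trans (lerD (lerD (ler_normD _ _) (lexx _)) (lexx _)) _.
apply: le_trans (lerD (lerD (lerD h1 h2) sew) h3) _.
have W0 : 0 <= w (t - s) ^+ 2 by exact: sqr_ge0.
have q2 : L ^+ 2 <= L ^+ 6 by rewrite ler_weXn2l.
have q0 : 1 <= L ^+ 6 by rewrite exprn_ege1.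
have : (L * L + L ^+ 6 + (1 + rho) / 2 + L * L) * w (t - s) ^+ 2 <=
   (4 * L ^+ 6 + rho / 2) * w (t - s) ^+ 2.
  by rewrite ler_wpM2r//; move: q2; rewrite expr2; lra.
apply: le_trans; rewrite le_eqVlt; apply/orP; left; apply/eqP; ring.
Qed.

Lemma apriori (y : W) (Y : R -> W) (a b : R) : solution_path y Y ->
  0 <= a -> a <= b -> b <= T -> b - a <= 1 -> 14 * L ^+ 10 * w (b - a) <= 1 ->
  forall s t, a <= s -> s <= t -> t <= b ->
    `|solution_remainder Y s t| <= 9 * L ^+ 6 * w (t - s) ^+ 2.
Proof.
move=> Ysol a0 ab bT ba1 small.
have [rho rho0 Yrho] := path_remainder Ysol.
pose P x := forall s t, a <= s -> s <= t -> t <= b ->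
  `|solution_remainder Y s t| <= x * w (t - s) ^+ 2.
have L6 : 0 <= 4 * L ^+ 6 by rewrite mulr_ge0 ?exprn_ge0.
have Prho : P rho.
  by move=> s t as_ st tb; apply: Yrho => //; [exact: le_trans as_|exact: le_trans bT].
have [x /andP[x0 xle] Px] := halving_iteration
  (fun x x0 => @apriori_step y Y x a b Ysol a0 ab bT ba1 small x0)
  L6 rho0 Prho ltr01.
move=> s t as_ st tb; apply: le_trans (Px s t as_ st tb) _.
rewrite ler_wpM2r ?sqr_ge0//; apply: le_trans xle _.
have : 1 <= L ^+ 6 by rewrite exprn_ege1.
by lra.
Qed.

(** The constants N, S and N2 bound, respectively, the difference of the two
    solutions, its increments and the difference of their remainders; all
    conclusions are linear in (N, S, N2). *)
Section DifferenceOfSolutions.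
Variables (Y Y2 : R -> W) (N N2 S r om : R) (u m v : R).
Hypotheses (u0 : 0 <= u) (um : u <= m) (mv : m <= v) (vT : v <= T).
Hypotheses (N0 : 0 <= N) (N20 : 0 <= N2) (S0 : 0 <= S) (r0 : 0 <= r).
Hypothesis om_ge : w (v - u) = om.
Hypothesis Yum : `|Y m - Y u| <= r * om.
Hypothesis Y2um : `|Y2 m - Y2 u| <= r * om.
Hypothesis Du : `|Y2 u - Y u| <= N.
Hypothesis Dum : `|(Y2 m - Y m) - (Y2 u - Y u)| <= S * om.
Hypothesis R2um : `|solution_remainder Y2 u m| <= r * om ^+ 2.
Hypothesis Rum : `|solution_remainder Y2 u m - solution_remainder Y u m| <= N2 * om ^+ 2.

Let om0 : 0 <= om. Proof. by rewrite -om_ge. Qed.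
Let m0 : 0 <= m. Proof. exact: le_trans um. Qed.
Let mT : m <= T. Proof. exact: le_trans vT. Qed.
Let uT : u <= T. Proof. exact: le_trans mT. Qed.
Let w_um : w (m - u) <= om.
Proof. by rewrite -om_ge; apply: gauge_le; rewrite ?subr_ge0// lerD2r. Qed.

Let cross_le : (`|Y m - Y u| + `|Y2 m - Y2 u|) * `|Y2 u - Y u| <= 2 * r * N * om.
Proof.
have -> : 2 * r * N * om = (r * om + r * om) * N by ring.
by apply: ler_pM => //; rewrite ?lerD.
Qed.

Let spread_le : `|(Y2 m - Y m) - (Y2 u - Y u)| +
  (`|Y m - Y u| + `|Y2 m - Y2 u|) * `|Y2 u - Y u| <= (S + 2 * r * N) * om.
Proof. by rewrite [leRHS]mulrDl lerD. Qed.

Lemma first_order_error_difference_le :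
  `|first_order_error Y2 u m - first_order_error Y u m| <=
  (2 * L * r * (S + r * N) + L * N * r + L * N2) * om ^+ 2.
Proof.
have fE (Q : R -> W) : first_order_error Q u m =
    taylor_remainder F DF (Q u) (Q m - Q u) + DF (Q u) (solution_remainder Q u m).
  rewrite /first_order_error /taylor_remainder /solution_remainder /increment.
  by rewrite subrKC linearB; vring.
rewrite !fE.
have -> : taylor_remainder F DF (Y2 u) (Y2 m - Y2 u) + DF (Y2 u) (solution_remainder Y2 u m) -
   (taylor_remainder F DF (Y u) (Y m - Y u) + DF (Y u) (solution_remainder Y u m)) =
   (taylor_remainder F DF (Y2 u) (Y2 m - Y2 u) - taylor_remainder F DF (Y u) (Y m - Y u)) +
   (DF (Y2 u) - DF (Y u)) (solution_remainder Y2 u m) +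
   DF (Y u) (solution_remainder Y2 u m - solution_remainder Y u m).
  move: (solution_remainder Y2 u m) (solution_remainder Y u m) => a b.
  by rewrite !(add_lfunE, opp_lfunE) !linearB; vring.
have h1 : `|taylor_remainder F DF (Y2 u) (Y2 m - Y2 u) -
    taylor_remainder F DF (Y u) (Y m - Y u)| <=
    L * ((r * om + r * om) * (S * om + r * om * N)).
  apply: le_trans (field_rd FB _ _ _ _) _; rewrite ler_wpM2l//.
  rewrite ler_pM ?addr_ge0 ?mulr_ge0 ?lerD//; last by rewrite ler_pM.
  by rewrite (_ : _ - _ - _ = (Y2 m - Y m) - (Y2 u - Y u))//; vring.
have h2 : `|(DF (Y2 u) - DF (Y u)) (solution_remainder Y2 u m)| <= (L * N) * (r * om ^+ 2).
  apply: le_trans (lfun_norm_le _ _) _; rewrite ler_pM//.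
  by apply: le_trans (field_derivative_lip FB _ _) _; rewrite ler_wpM2l.
have h3 : `|DF (Y u) (solution_remainder Y2 u m - solution_remainder Y u m)| <=
    L * (N2 * om ^+ 2).
  apply: le_trans (lfun_norm_le _ _) _; rewrite ler_pM//.
  exact: field_derivative_norm FB _.
apply: le_trans (ler_normD _ _) _.
apply: le_trans (lerD (ler_normD _ _) (lexx _)) _.
apply: le_trans (lerD (lerD h1 h2) h3) _.
by rewrite le_eqVlt; apply/orP; left; apply/eqP; ring.
Qed.

Lemma field_increment_difference_le :
  `|(F (Y2 m) - F (Y2 u)) - (F (Y m) - F (Y u))| <= L * (S + 2 * r * N) * om.
Proof.
have -> : (F (Y2 m) - F (Y2 u)) - (F (Y m) - F (Y u)) =
  (F (Y2 m) - F (Y m)) - (F (Y2 u) - F (Y u)) by vring.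
apply: le_trans (field_sd FB _ _ _ _) _.
by rewrite -mulrA ler_wpM2l.
Qed.

Lemma area_form_increment_difference_le v1 v2 :
  `|area_form_increment Y2 u m v1 v2 - area_form_increment Y u m v1 v2| <=
  (3 * L ^+ 4 * (S + 2 * r * N) + 4 * L ^+ 4 * N) * om * (`|v1| * `|v2|).
Proof.
pose H y x1 x2 := second_field F DF y x1 x2.
have -> : area_form_increment Y2 u m v1 v2 - area_form_increment Y u m v1 v2 =
  ((H (Y2 m) (Z' m v1) (Z' m v2) - H (Y m) (Z' m v1) (Z' m v2)) -
   (H (Y2 u) (Z' m v1) (Z' m v2) - H (Y u) (Z' m v1) (Z' m v2))) +
  ((H (Y2 u) ((Z' m - Z' u) v1) (Z' m v2) - H (Y u) ((Z' m - Z' u) v1) (Z' m v2)) +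
   (H (Y2 u) (Z' u v1) ((Z' m - Z' u) v2) - H (Y u) (Z' u v1) ((Z' m - Z' u) v2))).
  rewrite /area_form_increment /area_form /H /second_field !(add_lfunE, opp_lfunE).
  by rewrite !linearB !(add_lfunE, opp_lfunE); vring.
have zl s (v' : V) : 0 <= s -> s <= T -> `|Z' s v'| <= L * `|v'|.
  move=> s0 sT; apply: le_trans (lfun_norm_le _ _) _; rewrite ler_wpM2r//.
  exact: driver_derivative_le DB _ s0 sT.
have zd (v' : V) : `|(Z' m - Z' u) v'| <= L * om * `|v'|.
  apply: le_trans (lfun_norm_le _ _) _; rewrite ler_wpM2r//.
  apply: le_trans (driver_derivative_increment_le DB u0 um mT) _.
  by rewrite ler_wpM2l.
have L2 : 0 <= 2 * L ^+ 2 by rewrite mulr_ge0 ?exprn_ge0.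
have L3 : 0 <= 3 * L ^+ 2 by rewrite mulr_ge0 ?exprn_ge0.
have h1 : `|(H (Y2 m) (Z' m v1) (Z' m v2) - H (Y m) (Z' m v1) (Z' m v2)) -
   (H (Y2 u) (Z' m v1) (Z' m v2) - H (Y u) (Z' m v1) (Z' m v2))| <=
   3 * L ^+ 2 * ((S + 2 * r * N) * om) * ((L * `|v1|) * (L * `|v2|)).
  apply: le_trans (second_field_sd FB _ _ _ _ _ _) _.
  rewrite ler_pM//; [|by rewrite ler_wpM2l|by rewrite ler_pM// zl].
  by apply: mulr_ge0 => //; apply: addr_ge0 => //; apply: mulr_ge0 => //; exact: addr_ge0.
have h2 : `|H (Y2 u) ((Z' m - Z' u) v1) (Z' m v2) - H (Y u) ((Z' m - Z' u) v1) (Z' m v2)| <=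
   2 * L ^+ 2 * N * ((L * om * `|v1|) * (L * `|v2|)).
  apply: le_trans (second_field_lip FB _ _ _ _) _.
  rewrite ler_pM//; [exact: mulr_ge0|by rewrite ler_wpM2l|].
  by rewrite ler_pM// ?zd// zl.
have h3 : `|H (Y2 u) (Z' u v1) ((Z' m - Z' u) v2) - H (Y u) (Z' u v1) ((Z' m - Z' u) v2)| <=
   2 * L ^+ 2 * N * ((L * `|v1|) * (L * om * `|v2|)).
  apply: le_trans (second_field_lip FB _ _ _ _) _.
  rewrite ler_pM//; [exact: mulr_ge0|by rewrite ler_wpM2l|].
  by rewrite ler_pM// ?zd// zl.
apply: le_trans (ler_normD _ _) _.
apply: le_trans (lerD (lexx _) (ler_normD _ _)) _.
apply: le_trans (lerD h1 (lerD h2 h3)) _.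
by rewrite le_eqVlt; apply/orP; left; apply/eqP; ring.
Qed.

Lemma defect_difference_le :
  `|defect (fun s t => germ Y2 s t - germ Y s t) u m v| <=
  ((2 * L * r * (S + r * N) + L * N * r + L * N2) + 2 * (L * (S + 2 * r * N)) +
   (3 * L ^+ 4 * (S + 2 * r * N) + 4 * L ^+ 4 * N)) * L ^+ 2 * om ^+ 3.
Proof.
have -> : defect (fun s t => germ Y2 s t - germ Y s t) u m v =
    defect (germ Y2) u m v - defect (germ Y) u m v by rewrite /defect; vring.
rewrite !defect_germ//.
have -> : - (first_order_error Y2 u m (Z' u (increment X m v)) +
     (F (Y2 m) - F (Y2 u)) (driver_error u m v) +
     ev (area_form_increment Y2 u m) (XX m v)) -
  - (first_order_error Y u m (Z' u (increment X m v)) +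
     (F (Y m) - F (Y u)) (driver_error u m v) +
     ev (area_form_increment Y u m) (XX m v)) =
  - ((first_order_error Y2 u m - first_order_error Y u m) (Z' u (increment X m v)) +
     ((F (Y2 m) - F (Y2 u)) - (F (Y m) - F (Y u))) (driver_error u m v) +
     ev (fun v1 v2 => area_form_increment Y2 u m v1 v2 - area_form_increment Y u m v1 v2) (XX m v)).
  rewrite (ev_sub evP (area_form_increment Y2 u m) (area_form_increment Y u m)).
  move: (first_order_error Y2 u m) (first_order_error Y u m) => e2 e1.
  move: (driver_error _ _ _) (Z' u _) => er x.
  by rewrite !(add_lfunE, opp_lfunE); vring.
rewrite normrN -om_ge.
have Q0 : 0 <= S + 2 * r * N by rewrite addr_ge0// !mulr_ge0.
apply: defect_terms_le => //.
- by rewrite !addr_ge0// !mulr_ge0// addr_ge0// mulr_ge0.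
- exact: mulr_ge0.
- by rewrite addr_ge0// !mulr_ge0 ?exprn_ge0.
- by rewrite om_ge; exact: first_order_error_difference_le.
- by rewrite om_ge; exact: field_increment_difference_le.
- by move=> v1 v2; rewrite om_ge; exact: area_form_increment_difference_le.
Qed.

End DifferenceOfSolutions.


(* By the a priori estimate, th bounds the coefficients of the increments and of
   the remainders of every solution on short intervals. *)
Let th : R := 10 * L ^+ 6.

(** The weight 8 th between the two bounds is chosen so that both improve from
    N to |Y2_a - Y_a| + N / 2 in the same step. *)
Definition solutions_close (Y Y2 : R -> W) (a b N : R) : Prop :=
  (forall s, a <= s -> s <= b -> `|Y2 s - Y s| <= N) /\
  (forall s t, a <= s -> s <= t -> t <= b ->
    `|solution_remainder Y2 s t - solution_remainder Y s t| <=
    8 * th * N * w (t - s) ^+ 2).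

Lemma difference_arith (N N2 S : R) : 0 <= N ->
  N2 = 8 * th * N -> S = L ^+ 3 * N + N2 ->
  L * (((2 * L * th * (S + th * N) + L * N * th + L * N2) +
    2 * (L * (S + 2 * th * N)) +
   (3 * L ^+ 4 * (S + 2 * th * N) + 4 * L ^+ 4 * N)) * L ^+ 2) <= 27 * th ^+ 4 * N.
Proof.
move=> N0 -> ->; rewrite /th.
have p k : (k <= 24)%N -> L ^+ k * N <= L ^+ 24 * N.
  by move=> k24; rewrite ler_wpM2r// ler_weXn2l.
have p7 := p 7%N isT; have p10 := p 10%N isT; have p13 := p 13%N isT.
have p16 := p 16%N isT.
have p24 : 0 <= L ^+ 24 * N by rewrite mulr_ge0 ?exprn_ge0.
lra.
Qed.

Lemma delta_increment_le (Y Y2 : R -> W) (N N2 u m : R) :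
  0 <= u -> u <= m -> m <= T -> m - u <= 1 -> 0 <= N2 ->
  `|Y2 u - Y u| <= N ->
  `|solution_remainder Y2 u m - solution_remainder Y u m| <= N2 * w (m - u) ^+ 2 ->
  `|(Y2 m - Y m) - (Y2 u - Y u)| <= (L ^+ 3 * N + N2) * w (m - u).
Proof.
move=> u0 um mT mu1 N20 Du Dr.
have N0 : 0 <= N by apply: le_trans Du.
have -> : (Y2 m - Y m) - (Y2 u - Y u) =
  (F (Y2 u) - F (Y u)) (Z' u (increment X u m)) +
  (solution_remainder Y2 u m - solution_remainder Y u m).
  rewrite /solution_remainder !(add_lfunE, opp_lfunE).
  by rewrite ![increment (_ : R -> W) _ _]/increment; vring.
apply: le_trans (ler_normD _ _) _; rewrite mulrDl lerD//.
  have -> : L ^+ 3 * N * w (m - u) = (L * N) * (L * (L * w (m - u))) by ring.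
  apply: le_trans (lfun_norm_le _ _) _; rewrite ler_pM//.
    by apply: le_trans (field_lip FB _ _) _; rewrite ler_wpM2l.
  apply: le_trans (lfun_norm_le _ _) _; rewrite ler_pM//.
    by apply: driver_derivative_le DB _ u0 _; exact: le_trans mT.
  exact (path_increment_le DB u0 um mT).
apply: le_trans Dr _; rewrite ler_wpM2l// expr2 ler_piMr//.
by apply: gauge_le1 => //; rewrite subr_ge0 um.
Qed.

(** The difference of the remainders is bounded by a multiple of N times w^2
    that is well below 8 th, plus a term in w^3; the increments of Y2 - Y are of
    order w. On a short interval the positive powers of w leave at most N / 2. *)
Lemma difference_step (y y2 : W) (Y Y2 : R -> W) (a b N : R) :
  solution_path y Y -> solution_path y2 Y2 ->
  0 <= a -> a <= b -> b <= T -> b - a <= 1 -> 27 * th ^+ 4 * w (b - a) <= 1 ->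
  0 <= N -> solutions_close Y Y2 a b N ->
  solutions_close Y Y2 a b (`|Y2 a - Y a| + N / 2).
Proof.
move=> Ysol Y2sol a0 ab bT ba1 small N0 [DN RN].
have th1 : 1 <= th by rewrite /th; have := exprn_ege1 6 L_ge1; lra.
have th0 : 0 <= th by exact: le_trans th1.
have pow k n : (k <= n)%N -> L ^+ k <= L ^+ n by move=> kn; rewrite ler_weXn2l.
have small14 : 14 * L ^+ 10 * w (b - a) <= 1.
  apply: le_trans small; rewrite ler_wpM2r// /th.
  have := pow 10%N 24%N isT; have : 0 <= L ^+ 24 by rewrite exprn_ge0.
  by lra.
have AY := apriori Ysol a0 ab bT ba1 small14.
have AY2 := apriori Y2sol a0 ab bT ba1 small14.
have [[J JP] Yc _] := Ysol; have [[J2 J2P] Y2c _] := Y2sol.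
pose N2 := 8 * th * N; pose S := L ^+ 3 * N + N2.
have N20 : 0 <= N2 by rewrite /N2 !mulr_ge0.
have S0 : 0 <= S by rewrite /S addr_ge0 ?mulr_ge0 ?exprn_ge0.
have th9 : 9 * L ^+ 6 <= th by rewrite /th; have := exprn_ge0 6 L_ge0; lra.
have thY : L ^+ 3 + 9 * L ^+ 6 <= th by rewrite /th; have := pow 3%N 6%N isT; lra.
have Dinc u m : a <= u -> u <= m -> m <= b ->
    `|(Y2 m - Y m) - (Y2 u - Y u)| <= S * w (m - u).
  move=> au um mb; apply: delta_increment_le => //.
  - exact: le_trans au.
  - exact: le_trans bT.
  - by apply: le_trans ba1; rewrite lerB.
  - by apply: DN => //; exact: le_trans mb.
  exact: RN.
have D0 : 0 <= `|Y2 a - Y a| by [].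
have thw : 18 * th * w (b - a) <= 1.
  apply: le_trans small; rewrite ler_wpM2r// ler_pM//.
    by rewrite ler_nat.
  by rewrite ler_eXnr.
split=> [s as_ sb|s t as_ st tb].
  have -> : Y2 s - Y s = (Y2 a - Y a) + ((Y2 s - Y s) - (Y2 a - Y a)) by vring.
  apply: le_trans (ler_normD _ _) _; rewrite lerD//.
  apply: le_trans (Dinc a s (lexx _) as_ sb) _.
  have wsa : w (s - a) <= w (b - a) by apply: gauge_le; rewrite ?subr_ge0// lerD2r.
  apply: (@le_trans _ _ (9 * th * N * w (b - a))).
    rewrite ler_pM// /S /N2 /th; have := ler_wpM2r N0 (pow 3%N 6%N isT).
    have : 0 <= L ^+ 6 * N by rewrite mulr_ge0 ?exprn_ge0.
    by lra.
  by have := ler_wpM2r N0 thw; lra.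
have s0 : 0 <= s by exact: le_trans as_.
have t0 : 0 <= t by exact: le_trans st.
have tT : t <= T by exact: le_trans bT.
have sT : s <= T by exact: le_trans tT.
have sb : s <= b by exact: le_trans tb.
have [sE|st'] := eqVneq s t.
  rewrite /solution_remainder /increment sE !(subrr, linear0, addr0) normr0.
  by rewrite !mulr_ge0 ?sqr_ge0// addr_ge0// divr_ge0.
have {}st' : s < t by rewrite lt_neqAle st' st.
have [JLs Ys] := JP s s0 sT; have [JLt Yt] := JP t t0 tT.
have [J2Ls Y2s] := J2P s s0 sT; have [J2Lt Y2t] := J2P t t0 tT.
rewrite (solution_remainder_eq Ys Yt) (solution_remainder_eq Y2s Y2t).
pose kappa := ((2 * L * th * (S + th * N) + L * N * th + L * N2) +
    2 * (L * (S + 2 * th * N)) +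
   (3 * L ^+ 4 * (S + 2 * th * N) + 4 * L ^+ 4 * N)) * L ^+ 2.
have kappa0 : 0 <= kappa.
  have Q0 : 0 <= S + 2 * th * N by rewrite addr_ge0// !mulr_ge0.
  apply: mulr_ge0; last exact: exprn_ge0.
  apply: addr_ge0; last by rewrite addr_ge0// !mulr_ge0 ?exprn_ge0.
  apply: addr_ge0; last by rewrite !mulr_ge0.
  by rewrite !addr_ge0// !mulr_ge0// addr_ge0// mulr_ge0.
have dA u v : s <= u -> u < v -> v <= t ->
    `|defect (fun p q => germ Y2 p q - germ Y p q) u ((u + v) / 2) v| <=
    kappa * w (v - u) ^+ 3.
  move=> su uv vt; set m := (u + v) / 2.
  have u0 : 0 <= u by exact: le_trans su.
  have um : u <= m by rewrite /m; lra.
  have mv : m <= v by rewrite /m; lra.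
  have vT : v <= T by exact: le_trans tT.
  have mT : m <= T by exact: le_trans vT.
  have au : a <= u by exact: le_trans su.
  have mb : m <= b by apply: le_trans mv _; apply: le_trans tb.
  have mu1 : m - u <= 1 by apply: le_trans ba1; rewrite lerB.
  have wum : w (m - u) <= w (v - u) by apply: gauge_le; rewrite ?subr_ge0// lerD2r.
  have wum2 : w (m - u) ^+ 2 <= w (v - u) ^+ 2 by rewrite lerXn2r// nnegrE.
  have L6 : 0 <= 9 * L ^+ 6 by rewrite mulr_ge0 ?exprn_ge0.
  have inc (Q : R -> W) : (forall s t, a <= s -> s <= t -> t <= b ->
      `|solution_remainder Q s t| <= 9 * L ^+ 6 * w (t - s) ^+ 2) ->
      `|Q m - Q u| <= th * w (v - u).
    move=> AQ; apply: le_trans (solution_increment_le u0 um mT mu1 L6 (AQ _ _ au um mb)) _.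
    by rewrite ler_pM// addr_ge0 ?exprn_ge0.
  apply: defect_difference_le => //.
  - exact: inc.
  - exact: inc.
  - by apply: DN => //; exact: le_trans mb.
  - by apply: le_trans (Dinc u m au um mb) _; rewrite ler_wpM2l.
  - by apply: le_trans (AY2 u m au um mb) _; rewrite ler_pM ?sqr_ge0.
  - by apply: le_trans (RN u m au um mb) _; rewrite ler_wpM2l.
have sew := sewing (gauge_half alpha) (gauge_ge0 alpha)
  (gauge_half_lt alpha_gt) (J := fun t => J2 t - J t) kappa0 s0 st'
  (partition_limitB J2Ls JLs) (partition_limitB J2Lt JLt) dA.
have {}sew : `|(J2 t - J t) - (J2 s - J s) - (germ Y2 s t - germ Y s t)| <=
    N * w (t - s) ^+ 2.
  apply: le_trans sew _; rewrite -/w (exprS (w (t - s)) 2) mulrA ler_wpM2r ?sqr_ge0//.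
  apply: (@le_trans _ _ (27 * th ^+ 4 * N * w (b - a))).
    rewrite ler_pM//; first by rewrite mulr_ge0 ?sewing_constant_ge0 ?gauge_half_lt.
      by apply: le_trans (difference_arith N0 (erefl N2) (erefl S)); rewrite ler_wpM2r.
    by apply: gauge_le => //; rewrite ?subr_ge0// lerB.
  have : 27 * th ^+ 4 * w (b - a) * N <= 1 * N by rewrite ler_wpM2r.
  by lra.
have ts1 : 0 <= t - s <= 1.
  by rewrite subr_ge0 st/=; apply: le_trans ba1; rewrite lerB.
have tsw := le_gauge_sqr alpha_le ts1; rewrite -/w in tsw.
have h1 : `|(F (Y2 s) - F (Y s)) (remainder X Z Z' s t)| <=
    (L * N) * (L * w (t - s) ^+ 2).
  apply: le_trans (lfun_norm_le _ _) _; rewrite ler_pM//.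
    apply: le_trans (field_lip FB _ _) _; rewrite ler_wpM2l//.
    exact: DN.
  exact (driver_remainder_le DB s0 st tT).
have zl (v' : V) : `|Z' s v'| <= L * `|v'|.
  apply: le_trans (lfun_norm_le _ _) _; rewrite ler_wpM2r//.
  exact: driver_derivative_le DB _ s0 sT.
have h2 : `|ev (area_form Y2 s) (XX s t) - ev (area_form Y s) (XX s t)| <=
    L * (2 * L ^+ 4 * N) * (L * w (t - s) ^+ 2).
  rewrite -(ev_sub evP).
  have B v1 v2 : `|area_form Y2 s v1 v2 - area_form Y s v1 v2| <=
      2 * L ^+ 4 * N * (`|v1| * `|v2|).
    apply: le_trans (second_field_lip FB _ _ _ _) _.
    have -> : 2 * L ^+ 4 * N * (`|v1| * `|v2|) =
      2 * L ^+ 2 * N * ((L * `|v1|) * (L * `|v2|)) by ring.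
    rewrite ler_pM ?mulr_ge0 ?exprn_ge0//; last by rewrite ler_pM ?zl.
    by rewrite ler_wpM2l ?mulr_ge0 ?exprn_ge0// DN.
  apply: le_trans (ev_bound evP _ B) _.
  by rewrite ler_wpM2l ?mulr_ge0 ?exprn_ge0//; exact (area_le DB s0 st tT).
have dc (q : R) : 0 <= q -> q <= T ->
    {within `[0, q], continuous (fun r => (F0 \o Y2) r - (F0 \o Y) r)}.
  by move=> q0 qT x; apply: continuousB; [exact: Y2c|exact: Yc].
have h3 : `|(vintegral `[0, t] (F0 \o Y2) - vintegral `[0, s] (F0 \o Y2)) -
    (vintegral `[0, t] (F0 \o Y) - vintegral `[0, s] (F0 \o Y))| <=
    L * (L * N) * w (t - s) ^+ 2.
  rewrite (_ : _ - _ = (vintegral `[0, t] (F0 \o Y2) - vintegral `[0, t] (F0 \o Y)) -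
    (vintegral `[0, s] (F0 \o Y2) - vintegral `[0, s] (F0 \o Y))); last by vring.
  rewrite -!vintegralB; try by [exact: Y2c|exact: Yc].
  apply: le_trans (drift_le s0 st (dc t t0 tT) (M := L * N) _) _.
    move=> r /andP[sr rt] /=; apply: le_trans (drift_lip FB _ _) _.
    rewrite ler_wpM2l//; apply: DN; first exact: le_trans sr.
    exact: le_trans tb.
  by rewrite ler_wpM2l// !mulr_ge0.
have W0 : 0 <= w (t - s) ^+ 2 by exact: sqr_ge0.
rewrite (_ : _ - _ = (F (Y2 s) - F (Y s)) (remainder X Z Z' s t) +
   (ev (area_form Y2 s) (XX s t) - ev (area_form Y s) (XX s t)) +
   ((J2 t - J t) - (J2 s - J s) - (germ Y2 s t - germ Y s t)) +
   ((vintegral `[0, t] (F0 \o Y2) - vintegral `[0, s] (F0 \o Y2)) -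
    (vintegral `[0, t] (F0 \o Y) - vintegral `[0, s] (F0 \o Y)))); last first.
  by rewrite !(add_lfunE, opp_lfunE); vring.
apply: le_trans (ler_normD _ _) _.
apply: le_trans (lerD (ler_normD _ _) (lexx _)) _.
apply: le_trans (lerD (lerD (ler_normD _ _) (lexx _)) (lexx _)) _.
apply: le_trans (lerD (lerD (lerD h1 h2) sew) h3) _.
have q : L ^+ 2 * N + 2 * L ^+ 6 * N + N + L ^+ 2 * N <=
    8 * th * (`|Y2 a - Y a| + N / 2).
  have q2 := ler_wpM2r N0 (pow 2%N 6%N isT).
  have q0 := ler_wpM2r N0 (pow 0%N 6%N isT).
  have q6 : 0 <= L ^+ 6 * N by rewrite mulr_ge0 ?exprn_ge0.
  have : 0 <= 8 * th * `|Y2 a - Y a| by rewrite !mulr_ge0.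
  by move: q0; rewrite expr0 /th; lra.
apply: le_trans (ler_wpM2r W0 q).
by rewrite le_eqVlt; apply/orP; left; apply/eqP; ring.
Qed.

Lemma local_lipschitz (y y2 : W) (Y Y2 : R -> W) (a b : R) :
  solution_path y Y -> solution_path y2 Y2 ->
  0 <= a -> a <= b -> b <= T -> b - a <= 1 -> 27 * th ^+ 4 * w (b - a) <= 1 ->
  (exists N, 0 <= N /\ solutions_close Y Y2 a b N) ->
  forall s, a <= s -> s <= b -> `|Y2 s - Y s| <= 2 * `|Y2 a - Y a|.
Proof.
move=> Ysol Y2sol a0 ab bT ba1 small [N [N0 NP]] s as_ sb.
apply/ler_addgt0Pr => eps eps0.
have [x /andP[x0 xle] [Px _]] := halving_iteration
  (fun x x0 => @difference_step y y2 Y Y2 a b x Ysol Y2sol a0 ab bT ba1 small x0)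
  (normr_ge0 _) N0 NP eps0.
exact: le_trans (Px s as_ sb) xle.
Qed.

End RoughStep.

(** * From local to global Lipschitz bounds *)

Section GlobalLipschitz.
Context {R : realType} {U V VV W : finNormedModType R}.
Variables (tens : {bilinear V -> V -> VV}) (alpha : R).
Hypothesis alpha_gt : 3^-1 < alpha.
Hypothesis alpha_le : alpha <= 2^-1.
Variables (L T : R) (F : W -> 'Hom(U, W)) (DF : W -> 'Hom(W, 'Hom(U, W)))
  (F0 : W -> W) (X : R -> V) (XX : R -> R -> VV) (Z : R -> U)
  (Z' : R -> 'Hom(V, U)) (ev : (V -> V -> W) -> VV -> W).
Hypothesis L_ge1 : 1 <= L.
Hypothesis FB : field_bounds L F DF F0.
Hypothesis DB : driver_bounds tens alpha L T X XX Z Z'.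
Hypothesis evP : tensor_evaluation tens L ev.
Hypothesis sewing_le : sewing_constant (gauge alpha 2^-1) <= L.
Hypothesis drift_le : forall (f : R -> W) (s t M : R), 0 <= s -> s <= t ->
    {within `[0, t], continuous f} ->
    (forall r, s <= r <= t -> `|f r| <= M) ->
    `|vintegral `[0, t] f - vintegral `[0, s] f| <= L * M * (t - s).

Let w := gauge alpha.
Let L_ge0 : 0 <= L. Proof. exact: le_trans L_ge1. Qed.

Definition step_constant : R := 27 * (10 * L ^+ 6) ^+ 4.

Definition step_length : R := (step_constant ^+ 3)^-1.

Lemma step_constant_ge1 : 1 <= step_constant.
Proof.
rewrite /step_constant exprMn -exprM mulrA.
have h : 1 <= L ^+ (6 * 4) by exact: exprn_ege1.
by apply: le_trans h _; rewrite ler_peMl ?exprn_ge0// -natrX -natrM ler1n.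
Qed.

Let K0 : 0 < step_constant. Proof. exact: lt_le_trans step_constant_ge1. Qed.

Lemma step_length_gt0 : 0 < step_length.
Proof. by rewrite invr_gt0 exprn_gt0. Qed.

Lemma step_length_le1 : step_length <= 1.
Proof. by rewrite invf_le1 ?exprn_gt0// exprn_ege1// step_constant_ge1. Qed.

(** As alpha > 1/3, (K^(-3))^alpha is at most K^(-1). *)
Lemma gauge_step_length : step_constant * gauge alpha step_length <= 1.
Proof.
rewrite mulrC -ler_pdivlMr// mul1r.
apply: (@le_trans _ _ (step_length `^ 3^-1)).
  rewrite /gauge ger_powR ?step_length_gt0 ?step_length_le1//; exact: ltW.
rewrite /step_length -exprVn -powR_mulrn ?invr_ge0 ?(ltW K0)//.
by rewrite -powRrM divff// powRr1// invr_ge0 ltW.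
Qed.

Variables (y y2 : W) (Y Y2 : R -> W).
Hypothesis Ysol : solution_path alpha T F DF F0 X XX Z Z' ev y Y.
Hypothesis Y2sol : solution_path alpha T F DF F0 X XX Z Z' ev y2 Y2.

Lemma vintegral_at0 (f : R -> W) : vintegral `[0, 0] f = 0.
Proof.
rewrite /vintegral big1// => i _.
by rewrite set_itv1 Rintegral_set1 scale0r.
Qed.

Lemma solution_start (q : W) (Q : R -> W) : 0 <= T ->
  solution_path alpha T F DF F0 X XX Z Z' ev q Q -> Q 0 = q.
Proof.
move=> T0 [[J JP] _ _]; have [JL ->] := JP 0 (lexx _) T0.
rewrite vintegral_at0 addr0.
suff -> : J 0 = 0 by rewrite addr0.
apply/eqP; rewrite -normr_le0; apply/ler_addgt0Pr => eps eps0; rewrite add0r.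
move/partition_limitP : JL => /(_ eps eps0)[delta _ /(_ [::])].
by rewrite /= sub0r normrN => h; apply/ltW/h.
Qed.

Lemma solutions_close_ex (a b : R) : 0 <= a -> a <= b -> b <= T -> b - a <= 1 ->
  exists N, 0 <= N /\ solutions_close alpha L F X Z' Y Y2 a b N.
Proof.
move=> a0 ab bT ba1.
have [_ _ [r r0 rP]] := Ysol; have [_ _ [r2 r20 r2P]] := Y2sol.
pose N := `|Y2 a - Y a| + (2 * L ^+ 3 + r + r2).
have L3 : 0 <= L ^+ 3 by exact: exprn_ge0.
have N0 : 0 <= N by rewrite /N !addr_ge0// mulr_ge0.
exists N; split => //; split=> [s as_ sb|s t as_ st tb].
  have sT : s <= T by exact: le_trans bT.
  have sa1 : s - a <= 1 by apply: le_trans ba1; rewrite lerB.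
  have wsa : gauge alpha (s - a) <= 1.
    by apply: gauge_le1 => //; rewrite subr_ge0 as_.
  have h1 := solution_increment_le alpha_gt L_ge1 FB DB a0 as_ sT sa1 r0 (rP _ _ a0 as_ sT).
  have h2 := solution_increment_le alpha_gt L_ge1 FB DB a0 as_ sT sa1 r20 (r2P _ _ a0 as_ sT).
  rewrite (_ : Y2 s - Y s = (Y2 a - Y a) + ((Y2 s - Y2 a) - (Y s - Y a))); last by vring.
  apply: le_trans (ler_normD _ _) _; rewrite lerD//.
  apply: le_trans (ler_normB _ _) _; apply: le_trans (lerD h2 h1) _.
  apply: (@le_trans _ _ ((L ^+ 3 + r2) * 1 + (L ^+ 3 + r) * 1)); last by lra.
  by rewrite lerD// ler_wpM2l// addr_ge0.
have s0 : 0 <= s by exact: le_trans as_.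
have tT : t <= T by exact: le_trans bT.
apply: le_trans (ler_normB _ _) _.
apply: le_trans (lerD (r2P _ _ s0 st tT) (rP _ _ s0 st tT)) _.
rewrite -mulrDl ler_wpM2r ?sqr_ge0//.
have L6 : 1 <= L ^+ 6 by exact: exprn_ege1.
apply: (@le_trans _ _ (1 * N)).
  by rewrite mul1r /N; have := normr_ge0 (Y2 a - Y a); lra.
by rewrite ler_wpM2r//; lra.
Qed.

Lemma iterated_lipschitz (n : nat) (t : R) : 0 <= t -> t <= T ->
  t <= step_length *+ n -> `|Y2 t - Y t| <= 2 ^+ n * `|y2 - y|.
Proof.
elim: n t => [|n ih] t t0 tT tn.
  have T0 : 0 <= T by exact: le_trans tT.
  have -> : t = 0 by apply/eqP; rewrite eq_le t0 andbT.
  by rewrite (solution_start T0 Ysol) (solution_start T0 Y2sol) expr0 mul1r.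
have [tn'|/ltW nt] := leP t (step_length *+ n).
  apply: le_trans (ih t t0 tT tn') _; rewrite ler_wpM2r// exprS.
  by rewrite ler_peMl ?exprn_ge0// ler1n.
have a0 : 0 <= step_length *+ n by rewrite mulrn_wge0// ltW// step_length_gt0.
have ta : t - step_length *+ n <= step_length by rewrite lerBlDr -mulrS.
have ta1 : t - step_length *+ n <= 1 by apply: le_trans step_length_le1.
have small : 27 * (10 * L ^+ 6) ^+ 4 * gauge alpha (t - step_length *+ n) <= 1.
  apply: le_trans gauge_step_length; rewrite -/step_constant ler_wpM2l ?(ltW K0)//.
  by apply: gauge_le => //; rewrite subr_ge0.
apply: le_trans (local_lipschitz alpha_gt alpha_le L_ge1 FB DB evP sewing_le drift_le
  Ysol Y2sol a0 nt tT ta1 small (solutions_close_ex a0 nt tT ta1) nt (lexx _)) _.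
rewrite exprS -mulrA ler_wpM2l//; apply: ih => //; exact: le_trans tT.
Qed.

Lemma global_lipschitz (t : R) : 0 <= t -> t <= T ->
  `|Y2 t - Y t| <= 2 ^+ (Num.truncn (T * step_constant ^+ 3)).+1 * `|y2 - y|.
Proof.
move=> t0 tT; apply: iterated_lipschitz => //; apply: le_trans tT _.
rewrite -[_ *+ _]mulr_natl /step_length ler_pdivlMr ?exprn_gt0//.
exact: ltW (truncnS_gt _).
Qed.

End GlobalLipschitz.

Section SolutionPaths.
Context {R : realType} {U V VV W : finNormedModType R}.
Variables (tens : {bilinear V -> V -> VV}) (alpha : R).
Hypothesis alpha_gt : 3^-1 < alpha.

Let alpha_gt0 : 0 < alpha. Proof. by apply: lt_trans alpha_gt. Qed.

(** Germs that depend on Y'_u have to agree only at times u >= a, where the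
    equation prescribes Y'. *)
Lemma partition_limit_eq (a b : R) (A B : R -> R -> W) (J : W) :
  (forall u v, a <= u -> A u v = B u v) ->
  is_partition_limit a b A J -> is_partition_limit a b B J.
Proof.
move=> AB /partition_limitP AJ; apply/partition_limitP => eps eps0.
have [delta delta0 dP] := AJ eps eps0; exists delta => // s abs sd.
suff <- : partition_sum A a s = partition_sum B a s by exact: dP.
case: abs => sp _; elim: s a AB sp {AJ dP sd} => //= x s ih a AB /andP[ax xs].
by rewrite AB// ih// => u v xu; apply: AB; exact: le_trans (ltW ax) xu.
Qed.

Lemma hoelder_seminorm_le {E : finNormedModType R} (gamma : R) (I : set R)
    (A : R -> R -> E) (C s t : R) : (hoelder_seminorm gamma I A <= C%:E)%E ->
  I s -> I t -> s < t -> `|A s t| <= C * (t - s) `^ gamma.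
Proof.
move=> AC Is It st; rewrite -ler_pdivrMr ?powR_gt0 ?subr_gt0// -lee_fin.
apply: le_trans AC; apply: ereal_sup_ubound.
by exists (s, t).
Qed.

Lemma hoelder_seminorm_ge0 {E : finNormedModType R} (gamma a b : R)
    (A : R -> R -> E) : a < b -> (0 <= hoelder_seminorm gamma `[a, b] A)%E.
Proof.
move=> ab; apply: (@le_trans _ _ (`|A a b| / (b - a) `^ gamma)%:E).
  by rewrite lee_fin divr_ge0// powR_ge0.
apply: ereal_sup_ubound; exists (a, b) => //.
by split; rewrite /= ?in_itv /= ?lexx ?(ltW ab).
Qed.

Lemma powR_double (x : R) : 0 <= x -> x `^ (2 * alpha) = gauge alpha x ^+ 2.
Proof. by move=> x0; rewrite mulrC powRrM powR_mulrn// powR_ge0. Qed.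

Lemma remainder0 {E : finNormedModType R} (X : R -> V) (Z : R -> E)
  (Z' : R -> 'Hom(V, E)) t : remainder X Z Z' t t = 0.
Proof. by rewrite /remainder /increment !subrr linear0 subrr. Qed.

(** The power M^2 comes from the area, whose seminorm enters the norm of the
    rough path through its square root. *)
Lemma driver_bounds_of_norms (T M L : R) (X : R -> V) (XX : R -> R -> VV)
    (Z : R -> U) (Z' : R -> 'Hom(V, U)) : 0 < T -> 0 <= M -> M <= L -> M ^+ 2 <= L ->
  is_rough_path alpha tens `[0, T] X XX ->
  (rough_norm alpha `[0%R, T] X XX <= M%:E)%E ->
  (controlled_norm alpha `[0%R, T] X Z Z' <= M%:E)%E ->
  driver_bounds tens alpha L T X XX Z Z'.
Proof.
move=> T0 M0 ML M2L [chen _].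
rewrite /rough_norm ge_max => /andP[XM XXM].
rewrite /controlled_norm !ge_max => /andP[/andP[_ Z'M] /andP[RM Z'HM]].
have I t : 0 <= t -> t <= T -> `[0, T]%classic t by move=> t0 tT; rewrite /= in_itv /= t0.
have chen' s u t : 0 <= s -> s <= u -> u <= t -> t <= T ->
    XX s t = XX s u + XX u t + tens (increment X s u) (increment X u t).
  move=> s0 su ut tT; apply: chen => //; apply: I => //.
  - by apply: le_trans tT; exact: le_trans ut.
  - exact: le_trans su.
  - exact: le_trans tT.
  - by apply: le_trans ut; exact: le_trans su.
have XX0 s : 0 <= s -> s <= T -> XX s s = 0.
  move=> s0 sT; have := chen' s s s s0 (lexx _) (lexx _) sT.
  rewrite /increment subrr linear0l addr0 => /eqP.
  by rewrite -subr_eq subrr eq_sym => /eqP.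
have L0 : 0 <= L by exact: le_trans ML.
have ext (E : finNormedModType R) (A : R -> R -> E) (C : R) (k : nat) :
    0 <= C -> C <= L -> (forall s, 0 <= s -> s <= T -> A s s = 0) ->
    (forall s t, 0 <= s -> s < t -> t <= T -> `|A s t| <= C * gauge alpha (t - s) ^+ k) ->
    forall s t, 0 <= s -> s <= t -> t <= T -> `|A s t| <= L * gauge alpha (t - s) ^+ k.
  move=> C0 CL A0 AC s t s0; rewrite le_eqVlt => /predU1P[<- sT|st tT].
    by rewrite A0// normr0 mulr_ge0// exprn_ge0// gauge_ge0.
  by apply: le_trans (AC _ _ s0 st tT) _; rewrite ler_wpM2r// exprn_ge0// gauge_ge0.
split=> //.
- move=> s t s0 st tT; rewrite -[gauge _ _]expr1; move: s t s0 st tT.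
  apply: (ext _ (increment X) M 1%N) => // [s _ _|s t s0 st tT]; first by rewrite /increment subrr.
  rewrite expr1; apply: (hoelder_seminorm_le XM) => //; apply: I => //.
  - by apply: le_trans tT; exact: ltW.
  - by apply: le_trans (ltW st).
- apply: (ext _ XX (M ^+ 2) 2%N) => // [|s t s0 st tT]; first exact: exprn_ge0.
  have Is : `[0, T]%classic s by apply: I => //; apply: le_trans tT; exact: ltW.
  have It : `[0, T]%classic t by apply: I => //; exact: le_trans (ltW st).
  have ts0 : 0 < t - s by rewrite subr_gt0.
  rewrite -powR_double ?(ltW ts0)// -ler_pdivrMr ?powR_gt0//.
  set q := (X in X <= _).
  have q0 : 0 <= q by rewrite divr_ge0// powR_ge0.
  have : ((q `^ 2^-1)%:E <= M%:E)%E.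
    rewrite -poweR_EFin; apply: le_trans XXM.
    have qle : (q%:E <= hoelder_seminorm (2 * alpha) `[0%R, T] XX)%E.
      by apply: ereal_sup_ubound; exists (s, t).
    apply: gt0_ler_poweR => //; rewrite in_itv /= leey andbT.
      by rewrite lee_fin.
    by apply: le_trans qle; rewrite lee_fin.
  rewrite lee_fin => qM.
  have -> : q = (q `^ 2^-1) ^+ 2.
    by rewrite -powR_mulrn ?powR_ge0// -powRrM mulVf// powRr1.
  by rewrite lerXn2r// nnegrE powR_ge0.
- move=> t t0 tT; apply: le_trans ML; rewrite -lee_fin; apply: le_trans Z'M.
  by apply: ereal_sup_ubound; exists t => //; exact: I.
- move=> s t s0 st tT; rewrite -[gauge _ _]expr1; move: s t s0 st tT.
  apply: (ext _ (fun s t => Z' t - Z' s) M 1%N) => // [s _ _|s t s0 st tT]; first by rewrite subrr.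
  rewrite expr1; apply: (hoelder_seminorm_le Z'HM) => //; apply: I => //.
  - by apply: le_trans tT; exact: ltW.
  - by apply: le_trans (ltW st).
apply: (ext _ (remainder X Z Z') M 2%N) => // [s _ _|s t s0 st tT]; first exact: remainder0.
rewrite -powR_double ?subr_ge0 ?(ltW st)//.
apply: (hoelder_seminorm_le RM) => //; apply: I => //.
- by apply: le_trans tT; exact: ltW.
- by apply: le_trans (ltW st).
Qed.

Lemma solution_path_of_solution (L T : R) (F : W -> 'Hom(U, W)) (F0 : W -> W)
    (X : R -> V) (XX : R -> R -> VV) (Z : R -> U) (Z' : R -> 'Hom(V, U))
    (ev : (V -> V -> W) -> VV -> W) (y : W) (Y : R -> W) (Y' : R -> 'Hom(V, W)) :
  0 < T -> 1 <= L -> field_bounds L F (Frechet F) F0 ->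
  driver_bounds tens alpha L T X XX Z Z' -> tensor_evaluation tens L ev ->
  is_solution alpha tens F F0 X XX Z Z' y Y Y' ->
  solution_path alpha T F (Frechet F) F0 X XX Z Z' ev y Y.
Proof.
move=> T0 L1 FB DB evP [Yc Yeq Y'E].
have L0 : 0 <= L by exact: le_trans L1.
have remE s t : 0 <= s -> remainder X Y Y' s t = solution_remainder F X Z' Y s t.
  by move=> s0; rewrite /remainder /solution_remainder Y'E// comp_lfunE.
have [rho rho0 rhoP] : exists2 rho : R, 0 <= rho & forall s t : R, 0 <= s -> s <= t ->
    t <= T -> `|solution_remainder F X Z' Y s t| <= rho * gauge alpha (t - s) ^+ 2.
  have hlt : (hoelder_seminorm (2 * alpha) `[0%R, T] (remainder X Y Y') < +oo)%E.
    apply: le_lt_trans (Yc T T0); rewrite /controlled_norm !le_max.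
    by rewrite lexx orbT.
  have h0 := hoelder_seminorm_ge0 (2 * alpha) (remainder X Y Y') T0.
  have hfin : hoelder_seminorm (2 * alpha) `[0%R, T] (remainder X Y Y') \is a fin_num.
    by rewrite ge0_fin_numE.
  exists (fine (hoelder_seminorm (2 * alpha) `[0%R, T] (remainder X Y Y'))).
    exact: fine_ge0.
  move=> s t s0 st tT; rewrite -remE//; move: st; rewrite le_eqVlt => /predU1P[->|st].
    by rewrite remainder0 normr0 mulr_ge0 ?fine_ge0 ?sqr_ge0.
  rewrite -powR_double ?subr_ge0 ?(ltW st)//; apply: (@hoelder_seminorm_le _ _ `[0%R, T]) => //.
  - by rewrite fineK.
  - by rewrite /= in_itv /= s0/=; apply: le_trans tT; exact: ltW.
  - by rewrite /= in_itv /= tT andbT; exact: le_trans (ltW st).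
split; last by exists rho.
  have /choice[J JP] : forall t : R, exists J : W, 0 <= t -> t <= T ->
      is_partition_limit 0 t (germ F (Frechet F) XX Z Z' ev Y) J /\
      Y t = y + J + vintegral `[0, t] (F0 \o Y).
    move=> t; have [t0|t0] := leP 0 t; last by exists 0.
    have [J JL Yt] := Yeq t t0; exists J => _ _; split=> //.
    apply: partition_limit_eq JL => u v u0; rewrite /rough_germ /germ; congr (_ + _).
    have AE : (fun v1 v2 => Frechet F (Y u) (Y' u v1) (Z' u v2)) = area_form F (Frechet F) Z' Y u.
      by apply: funext => v1; apply: funext => v2; rewrite Y'E// comp_lfunE.
    by rewrite AE (ev_lift evP)//; exact: area_form_bilinear.
  by exists J.
move=> t t0 tT.
apply: (@hoelder_continuous _ _ _ alpha (L * (L ^+ 3 + rho * gauge alpha T))) => //.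
  by rewrite mulr_ge0// addr_ge0 ?exprn_ge0// mulr_ge0// gauge_ge0.
move=> u v u0 uv vt; have vT : v <= T by exact: le_trans tT.
apply: le_trans (drift_lip FB _ _) _; rewrite -mulrA ler_wpM2l//.
rewrite (_ : Y v - Y u = F (Y u) (Z' u (increment X u v)) +
  solution_remainder F X Z' Y u v); last first.
  by rewrite /solution_remainder /increment; vring.
apply: le_trans (ler_normD _ _) _; rewrite mulrDl lerD//.
  exact (derivative_term_le L1 FB DB Y u0 uv vT).
apply: le_trans (rhoP u v u0 uv vT) _; rewrite expr2 -/(gauge alpha (v - u)) mulrA.
rewrite ler_wpM2r ?gauge_ge0// ler_wpM2l//; apply: gauge_le => //.
  by rewrite subr_ge0.
by rewrite lerBlDr; apply: le_trans vT _; rewrite lerDl.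
Qed.

End SolutionPaths.

(** * The derivative of the flow *)

Section FlowDerivative.
Context {R : realType}.

Lemma Frechet_le_lipschitz {E G : finNormedModType R} (f : E -> G) (K : R) (z : E) :
  0 <= K -> differentiable f z -> (forall p q, `|f q - f p| <= K * `|q - p|) ->
  `|Frechet f z| <= K.
Proof.
move=> K0 df fK; apply: opnorm_le => x x1; rewrite FrechetE//.
have : derivable f z x by exact: diff_derivable.
move=> /cvg_ex[l fl]; have ldf : 'd f z x = l.
  by rewrite -(deriveE x df); apply: cvg_lim fl.
rewrite ldf; have nfl := cvg_norm fl.
apply: (closed_cvg (fun r : R => r <= K) (@closed_le R K) _ _ (nfl _)).
near=> h => /=; rewrite normrZ normfV.
have h0 : 0 < `|h| by rewrite normr_gt0; near: h; exact: nbhs_dnbhs_neq.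
rewrite ler_pdivrMl//; apply: le_trans (fK _ _) _.
rewrite addrK normrZ mulrC ler_wpM2r// ler_piMr//.
Unshelve. all: by end_near. Qed.

Lemma logp_le (x K : R) : 1 <= K -> x <= K -> logp x <= ln K.
Proof.
move=> K1 xK; rewrite /logp ge_max ln_ge0// andbT.
have [x0|x0] := leP x 0; first by rewrite ln0// ln_ge0.
by rewrite ler_ln// posrE (lt_le_trans _ K1).
Qed.

End FlowDerivative.

Section PolynomialBound.
Context {R : realType}.

Lemma increasing_polynomial_typeP (A B : R) (n m : nat) : 0 <= A -> 0 <= B ->
  increasing_polynomial_type (fun _ y z : R => A * (B * (1 + y + z) ^+ n) ^+ m).
Proof.
move=> A0 B0.
have mono (s t : R) : 0 <= s -> s <= t ->
    A * (B * s ^+ n) ^+ m <= A * (B * t ^+ n) ^+ m.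
  move=> s0 st; have t0 := le_trans s0 st.
  rewrite ler_wpM2l// lerXn2r ?nnegrE ?mulr_ge0 ?exprn_ge0// ler_wpM2l//.
  by rewrite lerXn2r ?nnegrE.
split.
- by [].
- by move=> x y y' z x0 y0 z0 yy'; apply: mono; lra.
- by move=> x y z z' x0 y0 z0 zz'; apply: mono; lra.
exists (A * B ^+ m), (n * m)%N => x y z x0 y0 z0.
have s0 : 0 <= 1 + y + z by lra.
rewrite ger0_norm ?mulr_ge0 ?exprn_ge0 ?mulr_ge0 ?exprn_ge0//.
apply: le_trans (mono _ (1 + x + y + z) s0 _) _; first by lra.
by rewrite exprMn -exprM mulrA.
Qed.

End PolynomialBound.

Unset Implicit Arguments.
Set Strict Implicit.
Set Printing Implicit Defensive.

Theorem proposition4p4 (R : realType) (U V VV W : finNormedModType R)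
  (tens : {bilinear V -> V -> VV}) (tensP : is_tensor_product tens)
  (alpha : R) (alpha_gt : 3^-1 < alpha) (alpha_le : alpha <= 2^-1)
  (alpha_neq : alpha != 2^-1)
  (d : measure_display) (Omega : measurableType d) (P : probability Omega R)
  (theta : R -> Omega -> Omega) (thetaP : is_metric_dynamical_system P theta)
  (X : Omega -> R -> V) (XX : Omega -> R -> R -> VV)
  (XP : is_rough_path_cocycle theta alpha tens X XX)
  (Z : Omega -> R -> U) (Z' : Omega -> R -> 'Hom(V, U))
  (ZP : is_controlled_cocycle theta alpha X Z Z')
  (F : W -> 'Hom(U, W)) (FP : classCb 3 F)
  (F0 : W -> W) (F0P : classCb 1 F0)
  (phi : R -> Omega -> W -> W * 'Hom(V, W))
  (phiP : is_solution_cocycle alpha tens F F0 X XX Z Z' phi)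
  (phi_C1 : forall t omega, 0 <= t -> classC1 (on_states phi t omega))
  (T : R) (T_gt0 : 0 < T) :
  exists Qlin : R -> R -> R -> R, increasing_polynomial_type Qlin /\
    forall (omega : Omega) (z0 : W * 'Hom(V, W)),
      (ereal_sup [set (logp `|Frechet (on_states phi t omega) z0|)%:E
                   | t in `[0%R, T]%classic]
       <= (Qlin `|z0|
             (fine (controlled_norm alpha `[0%R, T]%classic
                      (X omega) (Z omega) (Z' omega)))
             (fine (rough_norm alpha `[0%R, T]%classic
                      (X omega) (XX omega))))%:E)%E.
Proof.
have [CF FB] := field_bounds_ex FP F0P.
have [Cev [ev evP]] := tensor_evaluation_ex tensP W.
have [Cd Cd0 driftP] := @vintegral_increment_ex R W.
pose Cs := sewing_constant (gauge alpha (2^-1 : R)).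
pose B := 1 + `|CF| + `|Cev| + Cd + `|Cs|.
have B1 : 1 <= B.
  by rewrite /B; have := normr_ge0 CF; have := normr_ge0 Cev; have := normr_ge0 Cs; lra.
have B0 : 0 <= B by exact: le_trans B1.
have [c c0 cE] : exists2 c : R, 0 <= c &
    forall l : R, step_constant l ^+ 3 = c * l ^+ 72.
  exists ((27 * 10 ^+ 4) ^+ 3) => [|l]; first by rewrite exprn_ge0// mulr_ge0.
  by rewrite /step_constant (exprMn 4) mulrA exprMn -!exprM.
pose A := 4 + T * c.
have A0 : 0 <= A by rewrite addr_ge0// mulr_ge0 ?(ltW T_gt0).
(* 72 = 3 * 24: the number of steps is T times the cube of step_constant, which
   has degree 24 in the bound L on the data. *)
exists (fun _ y z => A * (B * (1 + y + z) ^+ 2) ^+ 72); split.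
  exact: increasing_polynomial_typeP.
move=> omega z0.
set nZ := controlled_norm _ _ _ _ _; set nX := rough_norm _ _ _ _.
have nZ_lt : (nZ < +oo)%E by exact: (cc_controlled ZP).
have nX_lt : (nX < +oo)%E by exact: rough_finite (rpc_rough XP omega T_gt0).
have nX0 : (0 <= nX)%E by rewrite le_max poweR_ge0 orbT.
have nZ0 : (0 <= nZ)%E.
  by rewrite !le_max; apply/orP; right; apply/orP; left; exact: hoelder_seminorm_ge0.
have nXE : nX = (fine nX)%:E by rewrite fineK// ge0_fin_numE.
have nZE : nZ = (fine nZ)%:E by rewrite fineK// ge0_fin_numE.
have x0 : 0 <= fine nX by exact: fine_ge0.
have y0 : 0 <= fine nZ by exact: fine_ge0.
pose M := 1 + fine nZ + fine nX.
have M1 : 1 <= M by rewrite /M; lra.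
have M2 : 1 <= M ^+ 2 by exact: exprn_ege1.
pose L := B * M ^+ 2.
have BL : B <= L by rewrite /L ler_peMr.
have L1 : 1 <= L by exact: le_trans BL.
have L0 : 0 <= L by exact: le_trans L1.
have M2L : M ^+ 2 <= L by rewrite /L ler_peMl// exprn_ge0//; lra.
have ML : M <= L by apply: le_trans M2L; rewrite expr2 ler_peMr//; lra.
have leB (x : R) : x <= `|x| by exact: ler_norm.
have n1 := normr_ge0 CF; have n2 := normr_ge0 Cev; have n3 := normr_ge0 Cs.
have FBL : field_bounds L F (Frechet F) F0.
  by apply: FB; apply: le_trans (leB _) _; apply: le_trans BL; rewrite /B; lra.
have evL : tensor_evaluation tens L ev.
  by apply: evP; apply: le_trans (leB _) _; apply: le_trans BL; rewrite /B; lra.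
have sewL : sewing_constant (gauge alpha (2^-1 : R)) <= L.
  by apply: le_trans (leB _) _; apply: le_trans BL; rewrite -/Cs /B; lra.
have driftL (f : R -> W) (s t N : R) : 0 <= s -> s <= t ->
    {within `[0, t], continuous f} -> (forall r, s <= r <= t -> `|f r| <= N) ->
    `|vintegral `[0, t] f - vintegral `[0, s] f| <= L * N * (t - s).
  move=> s0 st fc fN; apply: le_trans (driftP f s t N s0 st fc fN) _.
  rewrite ler_wpM2r ?subr_ge0// ler_wpM2r//.
    by apply: le_trans (fN s _) => //; rewrite lexx st.
  by apply: le_trans BL; rewrite /B; lra.
have DB : driver_bounds tens alpha L T (X omega) (XX omega) (Z omega) (Z' omega).
  apply: (driver_bounds_of_norms (M := M)) => //.
  - by lra.
  - exact: (rpc_rough XP omega T_gt0).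
  - by rewrite -/nX nXE lee_fin /M; lra.
  - by rewrite -/nZ nZE lee_fin /M; lra.
have sol y : solution_path alpha T F (Frechet F) F0 (X omega) (XX omega) (Z omega)
    (Z' omega) ev y (fun t => (phi t omega y).1).
  have [ysol _] := phiP omega y.
  exact: (solution_path_of_solution alpha_gt T_gt0 L1 FBL DB evL ysol).
have [n nle lip1] : exists2 n : nat, n%:R <= T * (c * L ^+ 72) + 1 &
    forall t y y2, 0 <= t -> t <= T ->
      `|(phi t omega y2).1 - (phi t omega y).1| <= 2 ^+ n * `|y2 - y|.
  rewrite -cE.
  exists (Num.truncn (T * step_constant L ^+ 3)).+1 => [|t y y2 t0 tT].
    rewrite -natr1 lerD2r truncn_le.
    rewrite mulr_ge0 ?exprn_ge0 ?(ltW T_gt0)//.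
    exact: le_trans (step_constant_ge1 L1).
  exact: (global_lipschitz alpha_gt alpha_le L1 FBL DB evL sewL driftL (sol y) (sol y2)).
have two_n : 1 <= 2 ^+ n :> R by rewrite exprn_ege1// ler1n.
(* The second component F(Y_t) Z'_t of the state costs the factor L^2. *)
have lip t p q : 0 <= t -> t <= T ->
    `|on_states phi t omega q - on_states phi t omega p| <=
    (L ^+ 2 * 2 ^+ n) * `|q - p|.
  move=> t0 tT; rewrite /on_states.
  have base : `|(phi t omega q.1).1 - (phi t omega p.1).1| <= 2 ^+ n * `|q - p|.
    apply: le_trans (lip1 t _ _ t0 tT) _.
    by rewrite ler_wpM2l ?exprn_ge0// prod_normE le_max lexx.
  have deriv y : (phi t omega y).2 = (F (phi t omega y).1 \o Z' omega t)%VF.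
    by have [[_ _ ->]] := phiP omega y.
  have L2 : 1 <= L ^+ 2 by exact: exprn_ege1.
  rewrite prod_normE ge_max; apply/andP; split => /=.
    apply: le_trans base _; rewrite -mulrA ler_peMl// mulr_ge0// exprn_ge0.
  rewrite !deriv; apply: opnorm_le => x x1.
  rewrite !(add_lfunE, opp_lfunE, comp_lfunE).
  have -> : F (phi t omega q.1).1 (Z' omega t x) - F (phi t omega p.1).1 (Z' omega t x) =
     (F (phi t omega q.1).1 - F (phi t omega p.1).1) (Z' omega t x).
    by rewrite !(add_lfunE, opp_lfunE).
  apply: le_trans (lfun_norm_le _ _) _.
  have -> : L ^+ 2 * 2 ^+ n * `|q - p| = (L * (2 ^+ n * `|q - p|)) * (L * 1) by ring.
  rewrite ler_pM//.
    by apply: le_trans (field_lip FBL _ _) _; rewrite ler_wpM2l.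
  apply: le_trans (lfun_norm_le _ _) _; rewrite ler_pM//.
  exact: (driver_derivative_le DB).
apply: ub_ereal_sup => _ /= [t + <-]; rewrite in_itv /= => /andP[t0 tT].
have Lip0 : 1 <= L ^+ 2 * 2 ^+ n by rewrite mulr_ege1// exprn_ege1.
have dphi : `|Frechet (on_states phi t omega) z0| <= L ^+ 2 * 2 ^+ n.
  apply: Frechet_le_lipschitz; first exact: le_trans Lip0.
    by have [dphi _] := phi_C1 t omega t0; exact: dphi.
  by move=> p q; exact: lip.
rewrite lee_fin; apply: le_trans (logp_le Lip0 dphi) _.
have Lpos : 0 < L by exact: lt_le_trans L1.
rewrite lnM ?posrE ?exprn_gt0// !lnXn//.
have lnL : ln L <= L by exact/ltW/ln_sublinear.
have ln2 : ln 2 <= 1 :> R.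
  by have := @le_ln1Dx R 1; rewrite (_ : 1 + 1 = 2); [apply; lra|lra].
have LL : L <= L ^+ 72 by rewrite ler_eXnr.
have L72 : 1 <= L ^+ 72 by exact: exprn_ege1.
have h2 : ln 2 *+ n <= n%:R :> R.
  by rewrite -[leLHS]mulr_natr ler_piMl.
apply: (@le_trans _ _ (2 * L + n%:R)).
  by rewrite lerD// -[leLHS]mulr_natl ler_wpM2l.
rewrite /A -/M -/L; apply: le_trans (lerD (ler_wpM2l _ LL) nle) _ => //.
rewrite [leRHS]mulrDl -[T * c * _]mulrA.
by move: (L ^+ 72) L72 => q q1; lra.
Qed.
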